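(* Let $p\ge 3$ be a prime and let $L$ be a soluble $3$-dimensional $\mathbb{Z}_p$-Lie algebra associated to one of the families D, E, F, G described in the context, so that, for suitable $k,\iota\in\mathbb{N}_0$ and $*=\square$ or $*=\not\square$, $$\zeta_{L}(s)=\zeta_{\mathbb{Z}_p^3}(s)-Z_{*,k}(s-2)\,\zeta_p(2s-2)\,\zeta_p(s-2)\,p^{(2-s)(\iota+1)}(1-p^{-1})^{-1}.$$ For $n\in\mathbb{N}_0$ denote by $\sigma_n$ the number of subalgebras of $L$ of index at most $p^n$. Then there are constants $c_1,c_2\in\mathbb{R}$, depending on $L$, such that, for all $n\in\mathbb{N}_0$, $$c_1p^nn^2\le\sigma_n\le c_2p^nn^2\quad\text{if } *=\square \text{ and } k \text{ is even},$$ $$c_1p^nn\le\sigma_n\le c_2p^nn\quad\text{otherwise}.$$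
   Context: $\mathbb{Z}_p$ is the ring of $p$-adic integers, $\mathbb{Z}_p^*$ its group of units, $\mathbb{N}=\{1,2,\dots\}$, $\mathbb{N}_0=\mathbb{N}\cup\{0\}$. For a $\mathbb{Z}_p$-algebra $L$ additively isomorphic to $\mathbb{Z}_p^n$, $\zeta_L(s)=\sum_{H\le L}|L:H|^{-s}$, where the sum ranges over the subalgebras $H$ of finite index in $L$ and $s$ is a complex variable. Put $\zeta_p(s)=(1-p^{-s})^{-1}$ and $\zeta_{\mathbb{Z}_p^3}(s)=\zeta_p(s)\zeta_p(s-1)\zeta_p(s-2)$, the zeta function of the abelian $3$-dimensional $\mathbb{Z}_p$-Lie algebra. Identities are identities of rational functions in $p^{-s}$. For $f\in\mathbb{Z}_p[x_1,\dots,x_n]$, Igusa's local zeta function is $Z_f(s)=\int_{\mathbb{Z}_p^n}|f(\mathbf{x})|_p^s\,d\mu$, with $|\cdot|_p$ the $p$-adic absolute value and $\mu$ the normalised additive Haar measure. For $k\in\mathbb{N}_0$ and $f(x_2,x_3)=x_2^2-\delta x_3^2$ with $\delta\in\mathbb{Z}_p$, set: $Z_{\not\square,k}(s):=Z_f(s)$ if $\delta=p^k\rho$ with $\rho\in\mathbb{Z}_p^*$ a non-square modulo $p$; and $Z_{\square,k}(s):=Z_f(s)$ if $\delta=p^ku^2$ with $u\in\mathbb{Z}_p^*$. The families are as follows; each Lie algebra has a $\mathbb{Z}_p$-basis $(e_1,e_2,e_3)$ with $[e_2,e_3]=0$. Family D: $L_2(0,r,d)$, $r\in\mathbb{N}$,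 $d\in\mathbb{Z}_p$: $[e_1,e_2]=-e_2-p^rd\,e_3$, $[e_1,e_3]=-p^re_2-e_3$. Family E: $L_3(0,r,d)$, $r\in\mathbb{N}_0$, $d\in\mathbb{Z}_p$: $[e_1,e_2]=-d\,e_3$, $[e_1,e_3]=-e_2-p^re_3$. Family F: $L_4(0,r)$, $r\in\mathbb{N}_0$: $[e_1,e_2]=-p^re_3$, $[e_1,e_3]=-e_2$. Family G: $L_5(0,r)$, $r\in\mathbb{N}_0$: $[e_1,e_2]=-p^r\rho\,e_3$, $[e_1,e_3]=-e_2$, where $\rho\in\mathbb{Z}_p^*$ is a non-square modulo $p$. These Lie algebras are maximal representatives of homothety classes; $L$ is associated to one of the families if it is isomorphic to $p^iL_0$ for some $i\in\mathbb{N}_0$ and some $L_0$ in that family, where $p^iL_0$ has the structure constants of $L_0$ multiplied by $p^i$.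
   Formalization: The upper bound is stated only for n ≥ 1, since at n = 0 it fails (σ_0 = 1 while p^0·0^2 = p^0·0 = 0); the lower bound is for all n, with c_1 > 0 required. *)

(* Defs.v *)
From HB Require Import structures.
From mathcomp Require Import all_boot all_order all_algebra.
From mathcomp Require Import finmap.
From mathcomp Require Import all_classical all_reals all_analysis.
From mathcomp Require Import complex.
From mathcomp Require Import ring.

Set Implicit Arguments.
Unset Strict Implicit.
Unset Printing Implicit Defensive.

Import Order.TTheory GRing.Theory Num.Theory.

Local Open Scope classical_set_scope.
Local Open Scope ring_scope.

(* The p-adic integers, as the inverse limit of the rings Z/p^nZ. An element is
   the sequence of its residues modulo p^n: the coherence condition also forces
   [residue n] to be the representative in [0, p^n[. *)
Record padic (p : nat) := Padic {
  residue : nat -> int;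
  _ : forall n, residue n = (residue n.+1 %% (p ^ n)%:Z)%Z }.

Section PadicRing.
Variable p : nat.
Implicit Types x y z : padic p.

HB.instance Definition _ := gen_eqMixin (padic p).
HB.instance Definition _ := gen_choiceMixin (padic p).

Lemma residueP x n : residue x n = (residue x n.+1 %% (p ^ n)%:Z)%Z.
Proof. by case: x. Qed.

Lemma residue_mod x n : (residue x n %% (p ^ n)%:Z)%Z = residue x n.
Proof. by rewrite residueP modz_mod. Qed.

Lemma padic_eq x y : residue x =1 residue y -> x = y.
Proof.
case: x y => [x hx] [y hy] /= /funext xy; rewrite xy in hx *.
by rewrite (Prop_irrelevance hx hy).
Qed.

Lemma modz_pow (m : int) n :
  ((m %% (p ^ n.+1)%:Z)%Z %% (p ^ n)%:Z)%Z = (m %% (p ^ n)%:Z)%Z.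
Proof.
rewrite [in RHS](intdiv.divz_eq m (p ^ n.+1)%:Z).
have E : (p ^ n.+1)%:Z = p%:Z * (p ^ n)%:Z by rewrite expnS PoszM.
by rewrite [X in _ * X + _]E mulrA modzMDl.
Qed.

Lemma coherent_of_int (m : int) n :
  (m %% (p ^ n)%:Z)%Z = ((m %% (p ^ n.+1)%:Z)%Z %% (p ^ n)%:Z)%Z.
Proof. by rewrite modz_pow. Qed.

Definition padic_of_int (m : int) : padic p := Padic (coherent_of_int m).

Lemma coherent_add x y n :
  ((residue x n + residue y n) %% (p ^ n)%:Z)%Z =
  (((residue x n.+1 + residue y n.+1) %% (p ^ n.+1)%:Z)%Z %% (p ^ n)%:Z)%Z.
Proof. by rewrite modz_pow !(residueP _ n) modzDm. Qed.

Lemma coherent_mul x y n :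
  ((residue x n * residue y n) %% (p ^ n)%:Z)%Z =
  (((residue x n.+1 * residue y n.+1) %% (p ^ n.+1)%:Z)%Z %% (p ^ n)%:Z)%Z.
Proof. by rewrite modz_pow !(residueP _ n) modzMm. Qed.

Lemma coherent_opp x n :
  ((- residue x n) %% (p ^ n)%:Z)%Z =
  (((- residue x n.+1) %% (p ^ n.+1)%:Z)%Z %% (p ^ n)%:Z)%Z.
Proof. by rewrite modz_pow (residueP _ n) modzNm. Qed.

Definition padic_add x y : padic p := Padic (coherent_add x y).
Definition padic_mul x y : padic p := Padic (coherent_mul x y).
Definition padic_opp x : padic p := Padic (coherent_opp x).

Fact padic_addA : associative padic_add.
Proof. by move=> x y z; apply: padic_eq => n /=; rewrite modzDml modzDmr addrA. Qed.
Fact padic_addC : commutative padic_add.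
Proof. by move=> x y; apply: padic_eq => n /=; rewrite addrC. Qed.
Fact padic_add0 : left_id (padic_of_int 0) padic_add.
Proof. by move=> x; apply: padic_eq => n /=; rewrite mod0z add0r residue_mod. Qed.
Fact padic_addN : left_inverse (padic_of_int 0) padic_opp padic_add.
Proof. by move=> x; apply: padic_eq => n /=; rewrite modzDml addNr. Qed.

HB.instance Definition _ := GRing.isZmodule.Build (padic p)
  padic_addA padic_addC padic_add0 padic_addN.

Fact padic_mulA : associative padic_mul.
Proof. by move=> x y z; apply: padic_eq => n /=; rewrite modzMml modzMmr mulrA. Qed.
Fact padic_mulC : commutative padic_mul.
Proof. by move=> x y; apply: padic_eq => n /=; rewrite mulrC. Qed.
Fact padic_mul1 : left_id (padic_of_int 1) padic_mul.
Proof. by move=> x; apply: padic_eq => n /=; rewrite modzMml mul1r residue_mod. Qed.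
Fact padic_mulD : left_distributive padic_mul padic_add.
Proof.
move=> x y z; apply: padic_eq => n /=.
by rewrite modzMml modzDm mulrDl.
Qed.

HB.instance Definition _ := GRing.Zmodule_isComPzRing.Build (padic p)
  padic_mulA padic_mulC padic_mul1 padic_mulD.

Definition padic_unit (u : padic p) : Prop := exists v, u * v = 1.

Definition square_mod_p (a : padic p) : Prop :=
  exists y z : padic p, a = y ^+ 2 + p%:R * z.

(* The p-adic valuation: the largest n such that x is 0 modulo p^n (and, as a
   junk value, 0 if x = 0). *)
Definition padic_val (x : padic p) : nat :=
  match pselect (exists n, residue x n.+1 != 0) with
  | left ex => ex_minn ex
  | right _ => 0%N
  end.

Definition padic_abs (R : realType) (x : padic p) : R :=
  if x == 0 then 0 else p%:R ^- padic_val x.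

End PadicRing.

Section LieAlgebras.
Variable p : nat.

Record lieAlgebra := LieAlgebra {
  lie_sort :> lmodType (padic p);
  lie_br : lie_sort -> lie_sort -> lie_sort;
  lie_brDl : forall a x y z, lie_br (a *: x + y) z = a *: lie_br x z + lie_br y z;
  lie_brDr : forall a x y z, lie_br z (a *: x + y) = a *: lie_br z x + lie_br z y;
  lie_brxx : forall x, lie_br x x = 0;
  lie_jacobi : forall x y z,
    lie_br x (lie_br y z) + lie_br y (lie_br z x) + lie_br z (lie_br x y) = 0 }.

Definition lie_iso (L M : lieAlgebra) : Prop :=
  exists2 f : {linear L -> M},
    bijective f & forall x y, f (lie_br x y) = lie_br (f x) (f y).

Definition free_of_rank (n : nat) (V : lmodType (padic p)) : Prop :=
  exists f : {linear V -> 'rV[padic p]_n}, bijective f.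

Definition submodule (V : lmodType (padic p)) (H : set V) : Prop :=
  H 0 /\ forall a x y, H x -> H y -> H (a *: x + y).

Definition subalgebra (L : lieAlgebra) (H : set L) : Prop :=
  submodule H /\ forall x y, H x -> H y -> H (lie_br x y).

Fixpoint derived (L : lieAlgebra) (n : nat) : set L :=
  if n is m.+1 then
    smallest (@submodule L)
      [set z | exists x y, [/\ derived m x, derived m y & z = lie_br x y]]
  else setT.

Definition soluble (L : lieAlgebra) : Prop := exists n, derived (L := L) n = [set 0].

Definition cosets (L : lieAlgebra) (H : set L) : set (set L) :=
  range (fun x => [set y | H (y - x)]).

Definition finite_index (L : lieAlgebra) (H : set L) : Prop :=
  finite_set (cosets H).

(* |L : H|, meaningful when H has finite index *)
Definition index (L : lieAlgebra) (H : set L) : nat := #|` fset_set (cosets H)|.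

Definition nb_subalgebras_upto (L : lieAlgebra) (N : nat) : nat :=
  #|` fset_set [set H : set L |
        [/\ subalgebra H, finite_index H & (index H <= N)%N]]|.

(* p^i L: the sublattice p^i L of L is identified with L through x |-> p^i x, so
   that only the bracket changes. *)
Section Homothety.
Variables (i : nat) (L : lieAlgebra).
Definition homothety_br (x y : L) : L := (p%:R ^+ i) *: lie_br x y.

Fact homothety_brDl a x y z :
  homothety_br (a *: x + y) z = a *: homothety_br x z + homothety_br y z.
Proof. by rewrite /homothety_br lie_brDl scalerDr !scalerA mulrC. Qed.
Fact homothety_brDr a x y z :
  homothety_br z (a *: x + y) = a *: homothety_br z x + homothety_br z y.
Proof. by rewrite /homothety_br lie_brDr scalerDr !scalerA mulrC. Qed.
Fact homothety_brxx x : homothety_br x x = 0.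
Proof. by rewrite /homothety_br lie_brxx scaler0. Qed.
Fact lie_brZr a (x y : L) : lie_br x (a *: y) = a *: lie_br x y.
Proof.
have br0 : lie_br x 0 = 0.
  by have := lie_brDr (-1) 0 0 x; rewrite scaler0 addr0 scaleN1r addNr.
by rewrite -[a *: y]addr0 lie_brDr br0 addr0.
Qed.
Fact homothety_jacobi x y z :
  homothety_br x (homothety_br y z) + homothety_br y (homothety_br z x)
    + homothety_br z (homothety_br x y) = 0.
Proof.
by rewrite /homothety_br !lie_brZr -!scalerDr lie_jacobi !scaler0.
Qed.

Definition homothety : lieAlgebra :=
  LieAlgebra homothety_brDl homothety_brDr homothety_brxx homothety_jacobi.
End Homothety.

Definition e1 : 'rV[padic p]_3 := delta_mx 0 (inord 0).
Definition e2 : 'rV[padic p]_3 := delta_mx 0 (inord 1).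
Definition e3 : 'rV[padic p]_3 := delta_mx 0 (inord 2).

(* The Lie algebra on Z_p^3 such that [e1,e2] = a e2 + b e3,
   [e1,e3] = c e2 + d e3 and [e2,e3] = 0. *)
Section Semidirect.
Variables a b c d : padic p.

Definition semidirect_br (x y : 'rV[padic p]_3) : 'rV[padic p]_3 :=
  (x 0 (inord 0) * y 0 (inord 1) - x 0 (inord 1) * y 0 (inord 0))
    *: (a *: e2 + b *: e3)
  + (x 0 (inord 0) * y 0 (inord 2) - x 0 (inord 2) * y 0 (inord 0))
    *: (c *: e2 + d *: e3).

Lemma semidirect_br12 : semidirect_br e1 e2 = a *: e2 + b *: e3.
Proof.
rewrite /semidirect_br !mxE -!val_eqE /= !inordK //=.
by rewrite !(mulr1, mulr0, subr0, scale1r, scale0r, addr0).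
Qed.
Lemma semidirect_br13 : semidirect_br e1 e3 = c *: e2 + d *: e3.
Proof.
rewrite /semidirect_br !mxE -!val_eqE /= !inordK //=.
by rewrite !(mulr1, mulr0, subr0, scale1r, scale0r) add0r.
Qed.
Lemma semidirect_br23 : semidirect_br e2 e3 = 0.
Proof.
rewrite /semidirect_br !mxE -!val_eqE /= !inordK //=.
by rewrite !(mul0r, mulr0, subr0, scale0r, addr0).
Qed.

Fact semidirect_brDl k x y z :
  semidirect_br (k *: x + y) z = k *: semidirect_br x z + semidirect_br y z.
Proof. by apply/rowP => j; rewrite !mxE; ring. Qed.
Fact semidirect_brDr k x y z :
  semidirect_br z (k *: x + y) = k *: semidirect_br z x + semidirect_br z y.
Proof. by apply/rowP => j; rewrite !mxE; ring. Qed.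
Fact semidirect_brxx x : semidirect_br x x = 0.
Proof. by apply/rowP => j; rewrite !mxE; ring. Qed.
Fact semidirect_jacobi x y z :
  semidirect_br x (semidirect_br y z) + semidirect_br y (semidirect_br z x)
    + semidirect_br z (semidirect_br x y) = 0.
Proof.
apply/rowP => j; rewrite !mxE -!val_eqE /= !inordK //=.
by case: (nat_of_ord j) => [|[|[|?]]] /=; ring.
Qed.

Definition semidirect : lieAlgebra :=
  LieAlgebra semidirect_brDl semidirect_brDr semidirect_brxx semidirect_jacobi.
End Semidirect.

(* L_2(0,r,d), L_3(0,r,d), L_4(0,r) and, with rho a unit which is not a square
   modulo p, L_5(0,r) *)
Definition lie_L2 (r : nat) (d : padic p) : lieAlgebra :=
  semidirect (-1) (- (p%:R ^+ r * d)) (- p%:R ^+ r) (-1).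
Definition lie_L3 (r : nat) (d : padic p) : lieAlgebra :=
  semidirect 0 (- d) (-1) (- p%:R ^+ r).
Definition lie_L4 (r : nat) : lieAlgebra :=
  semidirect 0 (- p%:R ^+ r) (-1) 0.
Definition lie_L5 (rho : padic p) (r : nat) : lieAlgebra :=
  semidirect 0 (- (p%:R ^+ r * rho)) (-1) 0.

Inductive in_family_DEFG : lieAlgebra -> Prop :=
| FamilyD r d : (0 < r)%N -> in_family_DEFG (lie_L2 r d)
| FamilyE r d : in_family_DEFG (lie_L3 r d)
| FamilyF r : in_family_DEFG (lie_L4 r)
| FamilyG r rho : padic_unit rho -> ~ square_mod_p rho ->
    in_family_DEFG (lie_L5 rho r).

Definition associated_DEFG (L : lieAlgebra) : Prop :=
  exists i L0, in_family_DEFG L0 /\ lie_iso L (homothety i L0).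

End LieAlgebras.

Section PadicSpace.
Variables (p n : nat).

(* Z_p^n; the alias carries the structures needed by measure theory *)
Definition padic_space : Type := 'rV[padic p]_n.
HB.instance Definition _ := Choice.on padic_space.
HB.instance Definition _ := isPointed.Build padic_space (0 : 'rV[padic p]_n).

Definition padic_open : set (set padic_space) :=
  [set U | forall x : 'rV[padic p]_n, U x -> exists m : nat,
     forall y : 'rV[padic p]_n, (forall j, residue (y 0 j) m = residue (x 0 j) m) -> U y].

Definition padic_borel := g_sigma_algebraType padic_open.

Definition normalised_haar (R : realType)
    (mu : {measure set padic_borel -> \bar R}) : Prop :=
  mu setT = 1%E /\
  forall (a : 'rV[padic p]_n) (A : set padic_borel), measurable A ->
    mu [set a + x | x in (A : set 'rV[padic p]_n)] = mu A.

End PadicSpace.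

Section Zeta.
Variable R : realType.
Local Notation C := (complex R).

(* x^s for a real base x >= 0 and a complex exponent s, with 0^s = 0 *)
Definition cpow (x : R) (s : C) : C :=
  if x == 0 then 0 else
  Complex (expR (complex.Re s * ln x) * cos (complex.Im s * ln x))
          (expR (complex.Re s * ln x) * sin (complex.Im s * ln x)).

(* Unordered sum over the index set D, as a difference of sums of nonnegative
   terms; it is the sum of the family whenever this is absolutely summable. *)
Definition rsum (T : choiceType) (D : set T) (f : T -> R) : R :=
  fine (\esum_(x in D) (f^\+ x)%:E) - fine (\esum_(x in D) (f^\- x)%:E).

Definition csum (T : choiceType) (D : set T) (f : T -> C) : C :=
  Complex (rsum D (fun x => complex.Re (f x)))
          (rsum D (fun x => complex.Im (f x))).

Definition cintegral d (T : measurableType d) (mu : {measure set T -> \bar R})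
    (f : T -> C) : C :=
  Complex (Rintegral mu setT (fun x => complex.Re (f x)))
          (Rintegral mu setT (fun x => complex.Im (f x))).

Definition subalgebra_zeta (p : nat) (L : lieAlgebra p) (s : C) : C :=
  csum [set H : set L | subalgebra H /\ finite_index H]
       (fun H => cpow (index H)%:R (- s)).

Definition zeta_p (p : nat) (s : C) : C := (1 - cpow p%:R (- s))^-1.

Definition zeta_Zp3 (p : nat) (s : C) : C :=
  zeta_p p s * zeta_p p (s - 1) * zeta_p p (s - 2).

Definition igusa_zeta (p n : nat) (mu : {measure set (padic_borel p n) -> \bar R})
    (f : 'rV[padic p]_n -> padic p) (s : C) : C :=
  cintegral mu (fun x : padic_borel p n => cpow (padic_abs R (f x)) s).

End Zeta.

Inductive square_type := Square | Nonsquare.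

(* The conditions on delta under which Z_{*,k} is the Igusa zeta function of
   x2^2 - delta x3^2 *)
Definition has_type (p : nat) (star : square_type) (k : nat) (delta : padic p) : Prop :=
  match star with
  | Square => exists2 u, padic_unit u & delta = p%:R ^+ k * u ^+ 2
  | Nonsquare => exists rho,
      [/\ padic_unit rho, ~ square_mod_p rho & delta = p%:R ^+ k * rho]
  end.

Definition binary_form (p : nat) (delta : padic p) (x : 'rV[padic p]_2) : padic p :=
  x 0 ord0 ^+ 2 - delta * x 0 ord_max ^+ 2.

(* Equality of rational functions in p^-s is stated as equality on some right
   half-plane of complex numbers s, where the series and the integral converge.
   Z_{*,k} is the Igusa zeta function of x2^2 - delta x3^2 for any delta of the
   type ( *, k). *)
Definition zeta_formula (R : realType) (p : nat)
    (mu : {measure set (padic_borel p 2) -> \bar R})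
    (L : lieAlgebra p) (star : square_type) (k iota : nat) : Prop :=
  exists2 delta : padic p, has_type star k delta &
  exists sigma : R, forall s : complex R, sigma < complex.Re s ->
    subalgebra_zeta L s =
      zeta_Zp3 p s
      - igusa_zeta mu (binary_form delta) (s - 2)
        * zeta_p p (2 * s - 2) * zeta_p p (s - 2)
        * cpow p%:R ((2 - s) * iota.+1%:R) * (1 - p%:R^-1)^-1.

Definition growth_exponent (star : square_type) (k : nat) : nat :=
  match star with
  | Square => if odd k then 1 else 2
  | Nonsquare => 1
  end.

(* Main.v *)
Require Import Defs.
From HB Require Import structures.
From mathcomp Require Import all_boot all_order all_algebra.
From mathcomp Require Import finmap.
From mathcomp Require Import all_classical all_reals all_analysis.
From mathcomp Require Import measurable_realfun complex.
From mathcomp Require Import zify ring lra.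
Set Implicit Arguments.
Unset Strict Implicit.
Unset Printing Implicit Defensive.
Import Order.TTheory GRing.Theory Num.Theory numFieldNormedType.Exports.
Local Open Scope classical_set_scope.
Local Open Scope ring_scope.

(** Write q = 1/p, t = p^-s, w = p t and u = p^2 t, and let T_j be the Haar
    measure of the set where p^j divides f = x2^2 - delta x3^2.

    Slicing the integral according to the valuation of f and summing by parts
    gives (1 - u) sum_j T_j u^j = 1 - u Z_f(s-2) (igusa_zeta_nat).  Substituted
    into the zeta formula, this cancels the pole at u = 1 and leaves
      zeta_L(s) = (sum_j S_j w^j - q / (1 - q w)) / ((1 - q) (1 - w^2)),
    where S_j = p^j T_(j-iota), and T_(j-iota) stands for 1 when j < iota.
    Hence the number of subalgebras of index p^n is p^n times the sum of the
    g_j = (S_j - q^(j+1)) / (1 - q) over the j <= n of the same parity as n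
    (subalg_coef_series).

    Since p^j T_j >= q for all j, the term q^(j+1) is at most q S_j for j > 0,
    so g_j is comparable to S_j and only the size of p^j T_j matters.  Now
    p^j T_j is p^-j times the number of solutions of a^2 = delta b^2 modulo p^j.
    If f is anisotropic (delta a nonsquare unit times p^k, or k odd), then
    p^j | f forces p^j | a^2 and p^j | delta b^2, and p^j T_j is bounded.  If
    delta = (p^m v)^2, then f splits into two linear factors over which the
    valuation j can be distributed in about j ways, and p^j T_j grows like j
    (density_bounds).  The sum over j contributes one more factor n, and sigma_n
    is a sum of terms growing like p^n, so it has the size of its last terms
    (subalg_coef_growth).

    The coefficients are read off from values at large natural numbers s.  There
    the right-hand side is a convergent series with positive value, so the sum
    over the subalgebras, which would have been recorded as 0 if it were
    infinite, is finite; in particular there are finitely many subalgebras of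
    each index (fibre_card_series).  Both sides are then Dirichlet series with
    nonnegative coefficients that agree at all large integers, and letting s
    tend to infinity isolates the coefficients one after the other
    (dirichlet_coef_eq). *)

(** * Counting the solutions of a^2 = d b^2 modulo p^j *)

(** A boolean predicate, so that residue classes can be counted by summing its
    values. *)
Definition ndvdz (n : nat) (x : int) : bool := (n%:Z %| x)%Z.

Lemma sum_congr_mul m M (c : int) : (0 < m)%N ->
  (\sum_(a < m * M) (ndvdz m (a%:Z - c)%R : nat))%N = M.
Proof.
move=> m0; elim: M => [|M IH]; first by rewrite muln0 big_ord0.
rewrite mulnSr big_split_ord /= IH -[RHS]addn1; congr addn.
have mz : m%:Z != 0 by rewrite eqz_nat -lt0n.
set c' : int := c - (m * M)%:Z.
have r_lt : (`|(c' %% m%:Z)%Z| < m)%N.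
  by rewrite -ltz_nat gez0_abs ?modz_ge0 // ltz_pmod.
rewrite (bigD1 (Ordinal r_lt)) //= big1 => [|i /eqP ni].
  rewrite /ndvdz PoszD gez0_abs ?modz_ge0 // addn0.
  have -> : (m * M)%:Z + (c' %% m%:Z)%Z - c = - ((c' %/ m%:Z)%Z * m%:Z).
    have E := intdiv.divz_eq c' m%:Z.
    have -> : (c' %% m%:Z)%Z = c' - ((c' %/ m%:Z)%Z * m%:Z) by rewrite {2}E addrC addKr.
    by rewrite /c'; ring.
  by rewrite dvdzE abszN -dvdzE dvdz_mull.
apply/eqP; rewrite eqb0; apply/negP => d; case: ni; apply/val_inj => /=.
suff -> : (c' %% m%:Z)%Z = i%:Z by [].
rewrite -[RHS](@modz_small i%:Z m%:Z) ?ltz_nat ?ltn_ord //; apply/eqP.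
have E : c' - i%:Z = - ((m * M + i)%N%:Z - c) by rewrite /c' PoszD; ring.
by rewrite eqz_mod_dvd E dvdzE abszN -dvdzE.
Qed.

Lemma sum_congr p i j (c : int) : (0 < p)%N -> (i <= j)%N ->
  (\sum_(a < p ^ j) (ndvdz (p ^ i) (a%:Z - c)%R : nat) = p ^ (j - i))%N.
Proof.
move=> p0 ij; have E : (p ^ j = p ^ i * p ^ (j - i))%N by rewrite -expnD subnKC.
by rewrite E sum_congr_mul // expn_gt0 p0.
Qed.

Lemma sum_dvd p i j : (0 < p)%N -> (i <= j)%N ->
  (\sum_(a < p ^ j) (ndvdz (p ^ i) a%:Z : nat) = p ^ (j - i))%N.
Proof.
move=> p0 ij; rewrite -(sum_congr 0 p0 ij).
by apply: eq_bigr => a _; rewrite subr0.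
Qed.

Section Prime.
Variables (p : nat) (p_prime : prime p).
Let p0 : (0 < p)%N := prime_gt0 p_prime.
Let p1 : (1 < p)%N := prime_gt1 p_prime.

(** Take i to be the smaller of j and the valuation of x. *)
Lemma ndvdz_exp_mulP j (x y : int) :
  ndvdz (p ^ j) (x * y) ->
  exists2 i, (i <= j)%N & ndvdz (p ^ i) x && ndvdz (p ^ (j - i)) y.
Proof.
rewrite /ndvdz !dvdzE abszM /=.
have [x0|x0] := posnP `|x|%N.
  by exists j => //; rewrite !dvdzE x0 dvdn0 subnn dvd1n.
have [y0|y0] := posnP `|y|%N.
  by exists 0%N => //; rewrite !dvdzE y0 dvdn0 dvd1n.
rewrite pfactor_dvdn ?muln_gt0 ?x0 // lognM // => h.
exists (minn j (logn p `|x|)); first exact: geq_minl.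
rewrite !dvdzE /= !pfactor_dvdn // geq_minr /=; lia.
Qed.

Lemma ndvdz_sqr j (x : int) : ndvdz (p ^ j) (x ^+ 2) = ndvdz (p ^ uphalf j) x.
Proof.
rewrite /ndvdz !dvdzE abszX /=.
have [->|x0] := posnP `|x|%N; first by rewrite !dvdn0.
rewrite !pfactor_dvdn ?expn_gt0 ?x0 // lognX.
apply/idP/idP; lia.
Qed.

Lemma ndvdz_mul_exp m j (x : int) :
  ndvdz (p ^ j) ((p ^ m)%:Z * x) = ndvdz (p ^ (j - m)) x.
Proof.
rewrite /ndvdz !dvdzE abszM /=.
have [->|x0] := posnP `|x|%N; first by rewrite !muln0 !dvdn0.
rewrite !pfactor_dvdn ?muln_gt0 ?expn_gt0 ?p0 // lognM ?expn_gt0 ?p0 //.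
by rewrite pfactorK // leq_subLR.
Qed.

Lemma ndvdz_unit j (u x : int) : ~~ ndvdz p u ->
  ndvdz (p ^ j) (u * x) = ndvdz (p ^ j) x.
Proof.
rewrite /ndvdz !dvdzE abszM /= => pu; rewrite Gauss_dvdr //.
by rewrite coprimeXl // prime_coprime.
Qed.

Lemma ndvdz_prime (x y : int) : ndvdz p (x * y) = ndvdz p x || ndvdz p y.
Proof. by rewrite /ndvdz !dvdzE abszM Euclid_dvdM. Qed.

Lemma ndvdz_le i j (x : int) : (i <= j)%N -> ndvdz (p ^ j) x -> ndvdz (p ^ i) x.
Proof. by move=> ij; apply: dvdn_trans; rewrite dvdn_exp2l. Qed.

Lemma ndvdz_pS j (x : int) : ndvdz (p ^ j.+1) x -> ndvdz p x.
Proof. by move/(@ndvdz_le 1 j.+1 _ isT); rewrite expn1. Qed.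

Lemma ndvdzP n (x : int) : reflect (exists y, x = n%:Z * y) (ndvdz n x).
Proof.
by apply: (iffP (@dvdzP n%:Z x)) => -[y ->]; exists y; rewrite mulrC.
Qed.

Lemma ndvdzD n (x y : int) : ndvdz n x -> ndvdz n (x + y) = ndvdz n y.
Proof. by rewrite /ndvdz => h; rewrite rpredDl. Qed.

Lemma ndvdzDr n (x y : int) : ndvdz n y -> ndvdz n (x + y) = ndvdz n x.
Proof. by rewrite addrC; apply: ndvdzD. Qed.

Lemma ndvdzN n (x : int) : ndvdz n (- x) = ndvdz n x.
Proof. by rewrite /ndvdz !dvdzE abszN. Qed.

Lemma ndvdz_mull n (x y : int) : ndvdz n y -> ndvdz n (x * y).
Proof. exact: dvdz_mull. Qed.

Lemma ndvdz_sqr_prime (x : int) : ndvdz p (x ^+ 2) = ndvdz p x.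
Proof. by rewrite expr2 ndvdz_prime orbb. Qed.

Lemma ndvdz_expn_gt0 k (x : int) : (0 < k)%N -> ndvdz p ((p ^ k)%:Z * x).
Proof.
by case: k => // k _; rewrite expnS PoszM -mulrA /ndvdz dvdz_mulr.
Qed.

Lemma inv_mod_prime (b : int) : ~~ ndvdz p b -> exists c, ndvdz p (b * c - 1).
Proof.
move=> pb; have /coprimezP[[u v] /= E] : coprimez b p%:Z.
  by rewrite /coprimez /gcdz /= -[_ == _]/(coprime _ _) coprime_sym prime_coprime.
exists u; have -> : b * u - 1 = - v * p%:Z by rewrite -E; ring.
by rewrite /ndvdz dvdz_mull.
Qed.

(** For k > 0 the second term vanishes modulo p.  For k = 0 the parity
    alternative is excluded; if p does not divide b, then a / b would be a
    square root of r modulo p, so p divides b and hence a^2. *)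
Lemma form_root_dvd_prime (r : int) k (a b : int) :
  odd k \/ (forall y : int, ~~ ndvdz p (y ^+ 2 - r)) ->
  ndvdz p (a ^+ 2 - (p ^ k)%:Z * r * b ^+ 2) -> ndvdz p a.
Proof.
case: k => [|k] hk.
  case: hk => // ns; rewrite expn0 mul1r => h.
  case: (boolP (ndvdz p b)) => [pb|/inv_mod_prime[c hc]].
    by rewrite -ndvdz_sqr_prime -(ndvdzDr _ (y := - (r * b ^+ 2))) //
       ndvdzN ndvdz_mull // ndvdz_sqr_prime.
  have := ns (a * c).
  have -> : (a * c) ^+ 2 - r = c ^+ 2 * (a ^+ 2 - r * b ^+ 2)
     + (r * (b * c + 1)) * (b * c - 1) by ring.
  by rewrite ndvdzDr ndvdz_mull.
rewrite -mulrA ndvdzDr ?ndvdzN ?ndvdz_expn_gt0 //.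
by rewrite ndvdz_sqr_prime.
Qed.

(** Descent on j: p divides a, and p^2 can be divided out of the whole relation,
    taking it from p^k when k > 1 and from b^2 otherwise, because then p divides
    r b^2.  Either move preserves the parity of k. *)
Lemma square_dvd_of_anisotropic (r : int) j k (a b : int) :
  ~~ ndvdz p r -> odd k \/ (forall y : int, ~~ ndvdz p (y ^+ 2 - r)) ->
  ndvdz (p ^ j) (a ^+ 2 - (p ^ k)%:Z * r * b ^+ 2) -> ndvdz (p ^ j) (a ^+ 2).
Proof.
move=> ur; elim/ltn_ind: j k a b => -[|j] IH k a b hk h; first exact: dvd1n.
have /ndvdzP[a' Ea] := form_root_dvd_prime hk (ndvdz_pS h).
case: j IH h => [|j] IH h; first by rewrite Ea expn1 ndvdz_sqr_prime /ndvdz dvdz_mulr.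
have p2 x : ndvdz (p ^ j.+2) ((p ^ 2)%:Z * x) = ndvdz (p ^ j) x.
  by rewrite ndvdz_mul_exp subn2.
have p2E : (p ^ 2)%:Z = p%:Z * p%:Z by rewrite expnS expn1 PoszM.
have Ea2 : a ^+ 2 = (p ^ 2)%:Z * a' ^+ 2.
  by rewrite Ea p2E; ring.
have pb : (k <= 1)%N -> ndvdz (p ^ j) (a' ^+ 2).
  move=> k1; have /ndvdzP[b' Eb] : ndvdz p b.
    have hr x : ndvdz p (p%:Z * x - r * b ^+ 2) -> ndvdz p b.
      rewrite ndvdzD ?ndvdzN; last by rewrite /ndvdz dvdz_mulr.
      by rewrite ndvdz_prime (negPf ur) ndvdz_sqr_prime.
    case: k k1 hk h => [|[|//]] _ hk h.
      apply: (hr (p%:Z * a' ^+ 2)); apply: (@ndvdz_pS j.+1).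
      move: h; rewrite Ea2 expn0 mul1r p2E.
      by congr (ndvdz _ (_ - _)); ring.
    apply: (hr (a' ^+ 2)); apply: (@ndvdz_pS j).
    have := ndvdz_mul_exp 1 j.+2 (p%:Z * a' ^+ 2 - r * b ^+ 2).
    rewrite subn1 /= => <-; move: h; rewrite Ea2 p2E !expn1.
    by congr ndvdz; ring.
  apply: (IH j _ k a' b' hk); first by lia.
  rewrite -p2; move: h; rewrite Ea2 Eb p2E.
  by congr ndvdz; ring.
rewrite Ea2 p2; case: (leqP k 1) => [/pb //|k2].
apply: (IH j _ (k - 2)%N a' b); first by lia.
  by case: hk => hk; [left; rewrite oddB // hk | right].
rewrite -p2; move: h; rewrite Ea2.
have -> : (p ^ k)%:Z = (p ^ 2)%:Z * (p ^ (k - 2))%:Z by rewrite -PoszM -expnD subnKC.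
by congr ndvdz; ring.
Qed.

Definition nb_sol (j : nat) (d : int) : nat :=
  (\sum_(b < p ^ j) \sum_(a < p ^ j)
    (ndvdz (p ^ j) (a%:Z ^+ 2 - d * b%:Z ^+ 2)%R : nat))%N.

Lemma nb_sol_congr j (d d' : int) :
  ndvdz (p ^ j) (d - d') -> nb_sol j d = nb_sol j d'.
Proof.
move=> dd'; apply: eq_bigr => b _; apply: eq_bigr => a _; congr nat_of_bool.
have -> : a%:Z ^+ 2 - d' * b%:Z ^+ 2
  = (a%:Z ^+ 2 - d * b%:Z ^+ 2) + b%:Z ^+ 2 * (d - d') by ring.
by rewrite [RHS]ndvdzDr // ndvdz_mull.
Qed.

Lemma leq_of_imply (x y : bool) : (x -> y) -> (x <= y)%N.
Proof. by case: x y => [] [] // /(_ isT). Qed.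

(** All pairs with a and b both divisible by p^(ceil (j/2)) are solutions. *)
Lemma nb_sol_ge j (d : int) : (p ^ j <= nb_sol j d * p)%N.
Proof.
have ej : (uphalf j <= j)%N by lia.
apply: (@leq_trans (p ^ (j - uphalf j) * p ^ (j - uphalf j) * p)%N).
  by rewrite -expnD -expnSr leq_exp2l //; lia.
rewrite leq_mul2r; apply/orP; right.
rewrite -{1}(sum_dvd p0 ej) big_distrl /=; apply: leq_sum => b _.
rewrite -(sum_dvd p0 ej) big_distrr /=; apply: leq_sum => a _.
rewrite mulnb; apply: leq_of_imply => /andP[hb ha].
rewrite -ndvdz_sqr in ha; rewrite -ndvdz_sqr in hb.
by rewrite ndvdzD // ndvdzN ndvdz_mull.
Qed.

(** By anisotropy p^j divides a^2 and p^k b^2 separately, which confines a to the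
    multiples of p^(ceil (j/2)) and b to those of p^(ceil ((j-k)/2)). *)
Lemma nb_sol_le_aniso (r : int) j k :
  ~~ ndvdz p r -> odd k \/ (forall y : int, ~~ ndvdz p (y ^+ 2 - r)) ->
  (nb_sol j ((p ^ k)%:Z * r) <= p ^ (j + k))%N.
Proof.
move=> ur hk; have ej : (uphalf j <= j)%N by lia.
have ek : (uphalf (j - k) <= j)%N by lia.
apply: (@leq_trans (p ^ (j - uphalf (j - k)) * p ^ (j - uphalf j))%N); last first.
  by rewrite -expnD leq_exp2l //; lia.
rewrite -(sum_dvd p0 ek) big_distrl /=; apply: leq_sum => b _.
rewrite -(sum_dvd p0 ej) big_distrr /=; apply: leq_sum => a _.
rewrite mulnb; apply: leq_of_imply => h.
have ha := square_dvd_of_anisotropic ur hk h; rewrite -!ndvdz_sqr ha andbT.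
by move: h; rewrite ndvdzD // ndvdzN -mulrA ndvdz_mul_exp ndvdz_unit.
Qed.

Section Square.
Variables (m : nat) (v : int).
Hypotheses (p_odd : (2 < p)%N) (uv : ~~ ndvdz p v).
Let alpha : int := (p ^ m)%:Z * v.

Lemma ndvdz_two_alpha j (x : int) : ndvdz (p ^ j) (2 * alpha * x) = ndvdz (p ^ (j - m)) x.
Proof.
have -> : 2 * alpha * x = (p ^ m)%:Z * ((2 * v) * x) by rewrite /alpha; ring.
rewrite ndvdz_mul_exp ndvdz_unit // ndvdz_prime negb_or uv andbT.
by rewrite /ndvdz dvdzE /=; apply/negP => /dvdn_leq => /(_ isT); lia.
Qed.

(** The form factors as (a - alpha b) (a + alpha b).  If p^i divides the first
    factor and p^(j-i) the second, the smaller of the two powers divides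
    2 alpha b, which restricts b, and the larger one fixes a modulo itself given
    b; each of the j + 1 values of i thus accounts for at most p^(j+m) pairs. *)
Lemma nb_sol_square_le j : (nb_sol j (alpha ^+ 2) <= j.+1 * p ^ (j + m))%N.
Proof.
pose P i (a b : int) := ndvdz (p ^ i) (a - alpha * b) && ndvdz (p ^ (j - i)) (a + alpha * b).
apply: (@leq_trans (\sum_(b < p ^ j) \sum_(a < p ^ j) \sum_(i < j.+1) (P i a%:Z b%:Z : nat))%N).
  apply: leq_sum => b _; apply: leq_sum => a _.
  case: (boolP (ndvdz _ _)) => // h.
  have [i ij Pi] : exists2 i, (i <= j)%N & P i a b.
    by apply: ndvdz_exp_mulP; move: h; congr ndvdz; ring.
  by rewrite (bigD1 (Ordinal (ij : (i < j.+1)%N))) //= Pi.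
rewrite (eq_bigr _ (fun b _ => exchange_big _ _ _ _ _ _)) exchange_big /=.
rewrite -[X in (_ <= X * _)%N]card_ord -sum_nat_const; apply: leq_sum => i _.
have ij : (i <= j)%N by rewrite -ltnS.
pose M := maxn i (j - i); pose mu := minn i (j - i).
have muj : (mu - m <= j)%N by rewrite /mu; lia.
have Mj : (M <= j)%N by rewrite /M; lia.
apply: (@leq_trans (p ^ (j - (mu - m)) * p ^ (j - M))%N); last first.
  by rewrite -expnD leq_exp2l // /M /mu; lia.
rewrite -(sum_dvd p0 muj) big_distrl /=; apply: leq_sum => b _.
(* The class of a modulo the larger power is that of alpha b or of - alpha b. *)
pose c := if (j - i <= i)%N then alpha * b%:Z else - (alpha * b%:Z).
rewrite -(sum_congr c p0 Mj) big_distrr /=; apply: leq_sum => a _.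
rewrite mulnb; apply: leq_of_imply => /andP[h1 h2]; apply/andP; split; last first.
  by rewrite /c /M; case: leqP => _; rewrite ?opprK.
rewrite -ndvdz_two_alpha.
have -> : 2 * alpha * b%:Z = (a%:Z + alpha * b%:Z) - (a%:Z - alpha * b%:Z) by ring.
rewrite ndvdzD ?ndvdzN; last by apply: ndvdz_le h2; exact: geq_minr.
by apply: ndvdz_le h1; exact: geq_minl.
Qed.

(** For i < j/2 - m, take the pairs with b of valuation exactly i and
    a = alpha b modulo p^(j-m-i): the first factor is divisible by p^(j-m-i),
    hence the second one, which differs from it by 2 alpha b, by p^(m+i).  The
    families for distinct i are disjoint, and each has at least p^(j-1) members. *)
Lemma nb_sol_square_ge_half j :
  ((j./2 - m) * p ^ j <= nb_sol j (alpha ^+ 2) * p)%N.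
Proof.
pose e i (b : int) := ndvdz (p ^ i) b && ~~ ndvdz (p ^ i.+1) b.
pose Q i (a b : int) := e i b && ndvdz (p ^ (j - m - i)) (a - alpha * b).
pose h := (j./2 - m)%N.
have QP (a b : int) i : (i < h)%N -> Q i a b -> ndvdz (p ^ j) (a ^+ 2 - alpha ^+ 2 * b ^+ 2).
  rewrite /h => ih /andP[/andP[hb _] hab].
  have hab2 : ndvdz (p ^ (m + i)) (a + alpha * b).
    have -> : a + alpha * b = (a - alpha * b) + 2 * alpha * b by ring.
    rewrite ndvdzD; first by rewrite ndvdz_two_alpha addKn.
    by apply: ndvdz_le hab; lia.
  have -> : a ^+ 2 - alpha ^+ 2 * b ^+ 2 = (a - alpha * b) * (a + alpha * b) by ring.
  have -> : (p ^ j = p ^ (j - m - i) * p ^ (m + i))%N by rewrite -expnD; congr expn; lia.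
  by rewrite /ndvdz PoszM dvdz_mul.
have e_inj (b : int) i i' : e i b -> e i' b -> i = i'.
  suff W i1 i2 : (i1 < i2)%N -> e i1 b -> ~~ e i2 b.
    move=> h1 h2; case: (ltngtP i i') => // /W.
      by move=> /(_ h1); rewrite h2.
    by move=> /(_ h2); rewrite h1.
  move=> i12 /andP[_ n1]; apply/negP => /andP[h2 _].
  by rewrite (ndvdz_le i12 h2) in n1.
have sum_Q : (\sum_(b < p ^ j) \sum_(a < p ^ j) \sum_(i < h) (Q i a%:Z b%:Z : nat)
    <= nb_sol j (alpha ^+ 2))%N.
  apply: leq_sum => b _; apply: leq_sum => a _.
  case: (pickP (fun i : 'I_h => Q i a%:Z b%:Z)) => [i Qi|none]; last first.
    by rewrite big1 // => i _; rewrite none.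
  rewrite (QP _ _ _ (ltn_ord i) Qi) (bigD1 i) //= Qi big1 ?addn0 // => i' ii'.
  apply/eqP; rewrite eqb0; apply/negP => Qi'; move/eqP: ii'; apply.
  by case/andP: Qi => ei _; case/andP: Qi' => ei' _; apply/val_inj/(e_inj b).
apply: leq_trans (leq_mul sum_Q (leqnn p)).
rewrite (eq_bigr _ (fun b _ => exchange_big _ _ _ _ _ _)) exchange_big /=.
rewrite -/h -{1}[h]card_ord -sum_nat_const big_distrl /=.
apply: leq_sum => -[i /= ih] _; rewrite /h in ih.
have sum_e : (\sum_(b < p ^ j) (e i b%:Z : nat) = p ^ (j - i) - p ^ (j - i.+1))%N.
  have [le_i le_i1] : (i <= j)%N /\ (i.+1 <= j)%N by lia.
  rewrite -(sum_dvd p0 le_i) -(sum_dvd p0 le_i1).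
  rewrite -sumnB => [|b _]; last by apply: leq_of_imply; apply: ndvdz_le.
  apply: eq_bigr => b _; rewrite /e.
  case: (boolP (ndvdz (p ^ i.+1) _)) => [/(ndvdz_le (leqnSn i)) ->|] //.
  by rewrite andbT subn0.
have -> : (\sum_(b < p ^ j) \sum_(a < p ^ j) (Q i a%:Z b%:Z : nat)
    = (p ^ (j - i) - p ^ (j - i.+1)) * p ^ (m + i))%N.
  rewrite -sum_e big_distrl /=; apply: eq_bigr => b _.
  have -> : (m + i = j - (j - m - i))%N by lia.
  have lj : (j - m - i <= j)%N by lia.
  rewrite -(sum_congr (alpha * b%:Z) p0 lj) big_distrr /=.
  by apply: eq_bigr => a _; rewrite mulnb.
have -> : (j - i = (j - i.+1).+1)%N by lia.
rewrite expnS -{2}[(p ^ (j - i.+1))%N]mul1n -mulnBl -!mulnA -expnSr -expnD.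
apply: leq_trans (leq_pmull _ _); last by rewrite subn_gt0.
by rewrite leq_exp2l //; lia.
Qed.

(** Once j >= 4m+3 one has j/2 - m >= (j+1)/4 (with j/2 rounded down); for smaller
    j the bound nb_sol_ge is enough because j + 1 < 4 (m+1). *)
Lemma nb_sol_square_ge j :
  (j.+1 * p ^ j <= nb_sol j (alpha ^+ 2) * (p * (4 * m.+1)))%N.
Proof.
rewrite mulnA; have [jm|jm] := leqP (4 * m + 3) j.
  apply: (@leq_trans (((j./2 - m) * p ^ j) * 4)%N).
    by rewrite mulnAC leq_mul2r; apply/orP; right; lia.
  apply: leq_mul; first exact: nb_sol_square_ge_half.
  lia.
rewrite mulnC; apply: leq_mul; first exact: nb_sol_ge.
lia.
Qed.
End Square.
End Prime.

(** * Haar measure and the Igusa zeta function *)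

Section Padic.
Variables (p : nat) (p_prime : prime p).
Let p0 : (0 < p)%N := prime_gt0 p_prime.

Lemma padic_mod_gt0 j : 0 < (p ^ j)%:Z.
Proof. by rewrite ltz_nat expn_gt0 p0. Qed.

Lemma padic_mod_neq0 j : (p ^ j)%:Z != 0.
Proof. by rewrite gt_eqF // padic_mod_gt0. Qed.

Lemma residue_ge0 (x : padic p) j : 0 <= residue x j.
Proof. by rewrite -residue_mod modz_ge0 // padic_mod_neq0. Qed.

Lemma residue_lt (x : padic p) j : residue x j < (p ^ j)%:Z.
Proof. by rewrite -residue_mod ltz_pmod // padic_mod_gt0. Qed.

Lemma residue_0 j : residue (0 : padic p) j = 0.
Proof. exact: mod0z. Qed.

Lemma residue_mod_le (x : padic p) i j : (i <= j)%N ->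
  residue x i = (residue x j %% (p ^ i)%:Z)%Z.
Proof.
elim: j => [|j IH]; first by rewrite leqn0 => /eqP->; rewrite residue_mod.
rewrite leq_eqVlt => /orP[/eqP->|]; first by rewrite residue_mod.
rewrite ltnS => ij; rewrite IH // (residueP x j).
have -> : (p ^ j)%:Z = (p ^ (j - i))%:Z * (p ^ i)%:Z by rewrite -PoszM -expnD subnK.
set d := (p ^ i)%:Z.
rewrite [in RHS](intdiv.divz_eq (residue x j.+1) ((p ^ (j - i))%:Z * d)).
by rewrite mulrA modzMDl.
Qed.

Lemma residue_eq0_le (x : padic p) i j : (i <= j)%N ->
  residue x j = 0 -> residue x i = 0.
Proof. by move=> /residue_mod_le -> ->; rewrite mod0z. Qed.

Lemma ndvdz_residueB (x : padic p) i j : (i <= j)%N ->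
  ndvdz (p ^ i) (residue x j - residue x i).
Proof.
by move=> ij; rewrite (residue_mod_le x ij) /ndvdz -eqz_mod_dvd modz_mod.
Qed.

Lemma residue_eq0 (x : padic p) : (forall j, residue x j = 0) -> x = 0.
Proof. by move=> h; apply: padic_eq => j; rewrite h residue_0. Qed.

(** The valuation of 0 being a default value, x must be nonzero. *)
Lemma padic_valP (x : padic p) j : x != 0 ->
  (residue x j == 0) = (j <= padic_val x)%N.
Proof.
move=> x0; rewrite /padic_val; case: pselect => [ex|/forallNP nex]; last first.
  case/eqP: x0; apply: residue_eq0 => -[|i].
    apply: (@residue_eq0_le _ 0 1) => //.
    by apply/eqP; move/negP: (nex 0); rewrite negbK.
  by apply/eqP; move/negP: (nex i); rewrite negbK.
case: ex_minnP => m hm minm; case: leqP => [jm|mj].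
  case: j jm => [|j] jm.
    have := residue_lt x 0; have := residue_ge0 x 0; lia.
  by apply/negP => /negP/minm; rewrite leqNgt jm.
by apply/negP => /eqP/(residue_eq0_le mj)/eqP; apply/negP.
Qed.

Lemma residue_binary_form (delta : padic p) (x : 'rV[padic p]_2) j :
  (residue (binary_form delta x) j == 0) =
  ndvdz (p ^ j) (residue (x 0 ord0) j ^+ 2
                 - residue delta j * residue (x 0 ord_max) j ^+ 2).
Proof.
rewrite /binary_form /= !(modzMml, modzMmr, modzDml, modzDmr, modzNm).
rewrite -[in LHS]modzDmr modzNm modzDmr /ndvdz -!expr2.
exact: (sameP eqP dvdz_mod0P).
Qed.

Local Notation V := (padic_borel p 2).
Local Notation x0 x := ((x : 'rV[padic p]_2) 0 ord0).
Local Notation x1 x := ((x : 'rV[padic p]_2) 0 ord_max).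

(** The balls of radius p^-j: there are p^(2j) of them, all translates of one
    another. *)
Definition cell j (ab : 'I_(p ^ j) * 'I_(p ^ j)) : set V :=
  [set x : V | residue (x0 x) j = ab.1%:Z /\ residue (x1 x) j = ab.2%:Z].

Lemma cell_measurable j ab : measurable (@cell j ab).
Proof.
apply: sub_sigma_algebra => x [h0 h1]; exists j => y hy.
by split; rewrite hy.
Qed.

Lemma ord_residue (x : padic p) j : exists a : 'I_(p ^ j), residue x j = a%:Z.
Proof.
have x_ge0 := residue_ge0 x j; have x_lt := residue_lt x j.
have h : (`|residue x j| < p ^ j)%N by rewrite -ltz_nat gez0_abs.
by exists (Ordinal h); rewrite /= gez0_abs.
Qed.

Lemma cell_trivIset j : trivIset setT (@cell j).
Proof.
move=> [a b] [a' b'] _ _ [x [[/= ha hb] [/= ha' hb']]].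
congr pair; apply/val_inj/eqP; rewrite -eqz_nat; apply/eqP.
  by rewrite -ha -ha'.
by rewrite -hb -hb'.
Qed.

Section Haar.
Variables (R : realType) (mu : {measure set V -> \bar R}).
Hypothesis mu_haar : normalised_haar mu.

Lemma cell_translate j a b :
  @cell j (a, b) =
  [set (\row_i padic_of_int p (if i == ord0 then a%:Z else b%:Z)) + (x : 'rV[padic p]_2)
    | x in [set x : V | residue (x0 x) j = 0 /\ residue (x1 x) j = 0]].
Proof.
apply/seteqP; split=> x /=; last first.
  move=> [y [h0 h1]] <-; split; rewrite /= !mxE /= ?h0 ?h1 addr0 modz_mod modz_small //.
    by rewrite ltz_nat ltn_ord.
  by rewrite ltz_nat ltn_ord.
move=> [/= h0 h1].
exists ((x : 'rV[padic p]_2) - \row_i padic_of_int p (if i == ord0 then a%:Z else b%:Z)).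
  by split; rewrite /= !mxE /= ?h0 ?h1 modzDmr -modzDmr modzNm modzDmr subrr mod0z.
by rewrite addrC subrK.
Qed.

(** The p^(2j) cells are disjoint, cover the space and have the same measure by
    translation invariance, so each has measure p^(-2j). *)
Lemma measure_residue_set j (P : int -> int -> bool) :
  measurable [set x : V | P (residue (x0 x) j) (residue (x1 x) j)] /\
  mu [set x : V | P (residue (x0 x) j) (residue (x1 x) j)] =
  ((\sum_(b < p ^ j) \sum_(a < p ^ j) (P a%:Z b%:Z : nat))%N%:R
     / (p ^ (2 * j))%:R)%:E.
Proof.
have m_residue (Q : int -> int -> bool) :
    measurable [set x : V | Q (residue (x0 x) j) (residue (x1 x) j)].
  by apply: sub_sigma_algebra => x Px; exists j => y hy /=; rewrite !hy.
split=> //.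
set B := [set x : V | residue (x0 x) j = 0 /\ residue (x1 x) j = 0].
have mB : measurable B.
  by apply: sub_sigma_algebra => x [h0 h1]; exists j => y hy; split; rewrite hy.
have muB c : mu (@cell j c) = mu B.
  by case: c => a b; rewrite cell_translate; apply: mu_haar.2.
have [r Br] : exists r, mu B = r%:E.
  exists (fine (mu B)); rewrite fineK // ge0_fin_numE ?measure_ge0 //.
  apply: (@le_lt_trans _ _ (mu setT)); last by rewrite mu_haar.1 ltry.
  by apply: le_measure; rewrite ?inE //; exact: measurableT.
have count (Q : int -> int -> bool) :
    mu [set x : V | Q (residue (x0 x) j) (residue (x1 x) j)] =
    ((\sum_(b < p ^ j) \sum_(a < p ^ j) (Q a%:Z b%:Z : nat))%N%:R * r)%:E.
  set s := [seq c : 'I_(p ^ j) * 'I_(p ^ j) <- index_enum _ | Q c.1%:Z c.2%:Z].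
  have -> : [set x : V | Q (residue (x0 x) j) (residue (x1 x) j)] =
      \bigcup_(c in [set` s]) cell c.
    apply/seteqP; split=> [x Qx|x [[a b]] /=].
      have [a ha] := ord_residue (x0 x) j; have [b hb] := ord_residue (x1 x) j.
      exists (a, b) => //=; rewrite mem_filter mem_index_enum andbT /=.
      by rewrite -ha -hb.
    by rewrite mem_filter => /andP[/= Qab _] [/= -> ->].
  rewrite measure_fin_bigcup ?finite_set //; last first.
  - by move=> c _; exact: cell_measurable.
  - exact: sub_trivIset (@cell_trivIset j).
  rewrite -fsbig_seq ?filter_uniq ?index_enum_uniq // big_filter.
  rewrite (eq_bigr (fun=> r%:E)) => [|c _]; last exact: etrans (muB c) Br.
  rewrite sumEFin sumr_const -[in LHS]mulr_natl; congr (_%:R * _)%:E.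
  rewrite -sum1_card big_mkcond exchange_big pair_bigA /=.
  by apply: eq_bigr => -[a b] _; rewrite unfold_in /=; case: (Q _ _).
rewrite count; congr (_ * _)%:E.
have := count (fun _ _ => true).
rewrite (_ : [set x : V | _] = setT); last by apply/seteqP; split.
rewrite mu_haar.1 => -[].
rewrite (eq_bigr (fun=> p ^ j)%N) => [|b _]; last first.
  by rewrite sum_nat_const card_ord muln1.
rewrite sum_nat_const card_ord -expnD addnn -mul2n => E.
have n0 : (p ^ (2 * j))%:R != 0 :> R by rewrite pnatr_eq0 -lt0n expn_gt0 p0.
by apply: (mulfI n0); rewrite -E divff.
Qed.


Lemma series_EFin (a : nat -> R) (l : R) :
  series a @ \oo --> l -> (\sum_(n <oo) (a n)%:E = l%:E)%E.
Proof.
move=> al; apply/cvg_lim => //; under eq_fun do rewrite sumEFin.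
exact/cvg_EFin/al/nearW.
Qed.

Lemma cpow_nat (x : R) n : 0 < x ->
  cpow x n%:R = real_complex R (x ^+ n).
Proof.
move=> x0; rewrite /cpow gt_eqF //.
have -> : (n%:R : complex R) = real_complex R n%:R by rewrite rmorph_nat.
by rewrite /= mul0r cos0 sin0 mulr1 mulr0 expRM_natl lnK.
Qed.

Lemma cpow_natN (x : R) n : 0 < x ->
  cpow x (- n%:R) = real_complex R (x ^- n).
Proof.
move=> x0; rewrite /cpow gt_eqF //.
have -> : (- n%:R : complex R) = real_complex R (- n%:R) by rewrite rmorphN rmorph_nat.
by rewrite /= mul0r cos0 sin0 mulr1 mulr0 mulNr expRN expRM_natl lnK.
Qed.

Section Igusa.
Variable (delta : padic p).

Definition form_set j : set V := [set x : V | residue (binary_form delta x) j = 0].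
(** The number T_j; measure_form_set identifies it with the measure of form_set. *)
Definition form_measure j : R :=
  (nb_sol p j (residue delta j))%:R / (p ^ (2 * j))%:R.

Lemma measure_form_set j :
  measurable (form_set j) /\ mu (form_set j) = (form_measure j)%:E.
Proof.
pose P (a b : int) := ndvdz (p ^ j) (a ^+ 2 - residue delta j * b ^+ 2).
have -> : form_set j = [set x : V | P (residue (x0 x) j) (residue (x1 x) j)].
  by apply/seteqP; split=> x; rewrite /form_set /P /= -residue_binary_form => /eqP.
exact: measure_residue_set.
Qed.

Lemma form_measure_ge0 j : 0 <= form_measure j.
Proof. by rewrite divr_ge0 ?ler0n. Qed.

Lemma form_measure_le1 j : form_measure j <= 1.
Proof.
have [mF muF] := measure_form_set j.
rewrite -lee_fin -muF -mu_haar.1; apply: le_measure; rewrite ?inE //.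
Qed.

Lemma form_measure0 : form_measure 0 = 1.
Proof.
have [_] := measure_form_set 0.
rewrite (_ : form_set 0 = setT) ?mu_haar.1; first by case.
apply/seteqP; split=> // x _.
have := residue_lt (binary_form delta x) 0; have := residue_ge0 (binary_form delta x) 0.
by rewrite /form_set /mkset expn0; lia.
Qed.

Section Value.
Variables (N : nat) (N_gt0 : (0 < N)%N).
Let u : R := p%:R ^- N.

Lemma u_gt0 : 0 < u. Proof. by rewrite invr_gt0 exprn_gt0 // ltr0n. Qed.

Lemma u_lt1 : u < 1.
Proof.
by rewrite invf_lt1 ?exprn_gt0 ?ltr0n // exprn_egt1 ?ltr1n ?prime_gt1 // -lt0n.
Qed.

Definition level_set j : set V := form_set j `\` form_set j.+1.

Lemma level_setE j (x : V) : binary_form delta x != 0 ->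
  level_set j x <-> j = padic_val (binary_form delta x).
Proof.
move=> fx0; split=> [[/eqP + /eqP]|->].
  by rewrite !padic_valP // -ltnNge ltnS => h1 h2; apply/eqP; rewrite eqn_leq h1.
by split; apply/eqP; rewrite padic_valP // ltnn.
Qed.

Lemma level_set0 j (x : V) : binary_form delta x = 0 -> ~ level_set j x.
Proof. by move=> fx0 [_]; rewrite /form_set /mkset fx0 residue_0. Qed.

(** Exactly one term is nonzero if f(x) <> 0, and none if f(x) = 0, in which case
    the right-hand side is 0 because N > 0. *)
Lemma padic_abs_series (x : V) :
  series (fun j => u ^+ j * \1_(level_set j) x) @ \oo -->
  (padic_abs R (binary_form delta x)) ^+ N.
Proof.
apply: cvg_near_cst; exists (padic_val (binary_form delta x)).+1 => // n /= hn.
rewrite /padic_abs; case: eqP => [fx0|/eqP fx0].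
  rewrite expr0n -[(N == 0)%N]negbK -lt0n N_gt0 /=.
  rewrite /series /= big1 // => j _.
  by rewrite indicE memNset ?mulr0 //; apply: level_set0.
rewrite /series /= (bigD1_seq (padic_val (binary_form delta x))) ?mem_index_iota ?iota_uniq //=.
rewrite big1 => [|j /eqP jv]; last first.
  by rewrite indicE memNset ?mulr0 // => /level_setE-/(_ fx0).
rewrite addr0 indicE mem_set ?mulr1; last exact/level_setE.
by rewrite /u -!exprVn -!exprM mulnC.
Qed.

Lemma measurable_level_set j : measurable (level_set j).
Proof. by apply: measurableD; exact: (measure_form_set _).1. Qed.

Lemma measure_level_set j :
  mu (level_set j) = (form_measure j - form_measure j.+1)%:E.
Proof.
have -> : mu (level_set j) = (mu (form_set j) - mu (form_set j `&` form_set j.+1))%E.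
  apply: measureD; [exact: (measure_form_set j).1|exact: (measure_form_set _).1|].
  by apply: (@le_lt_trans _ _ (form_measure j)%:E); rewrite ?ltry // -(measure_form_set j).2.
rewrite (measure_form_set j).2 (_ : _ `&` _ = form_set j.+1).
  by rewrite (measure_form_set _).2 EFinB.
apply/seteqP; split=> [x []//|x h]; split=> //.
exact: residue_eq0_le h.
Qed.

(** The integral of |f|^N is the sum of the u^j (T_j - T_(j+1)) by monotone
    convergence; summation by parts turns this into the stated relation. *)
Lemma igusa_zeta_nat : exists Z : R,
  igusa_zeta mu (binary_form delta) N%:R = real_complex R Z /\
  series (fun j => form_measure j * u ^+ j) @ \oo --> (1 - u * Z) / (1 - u).
Proof.
have u0 := u_gt0; have u1 := u_lt1.
pose T := form_measure.
have cvgP : cvgn (series (fun j => T j * u ^+ j)).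
  apply: (@series_le_cvg _ _ (geometric 1 u)).
  - by move=> j; rewrite mulr_ge0 ?form_measure_ge0 ?exprn_ge0 ?ltW.
  - by move=> j; rewrite /= mul1r exprn_ge0 ?ltW.
  - by move=> j; rewrite /= ler_wpM2r ?form_measure_le1 ?exprn_ge0 ?ltW.
  - by apply: is_cvg_geometric_series; rewrite ger0_norm ?ltW.
set P := limn _ in cvgP.
pose Z := (1 - (1 - u) * P) / u.
exists Z; split; last first.
  rewrite (_ : _ / _ = P) //.
  by rewrite /Z; field; rewrite !gt_eqF // subr_gt0.
have cvgZ : series (fun j => u ^+ j * (T j - T j.+1)) @ \oo --> Z.
  have -> : series (fun j => u ^+ j * (T j - T j.+1)) =
     (fun M => (1 - (series (fun j => T j * u ^+ j) M.+1
                      - u * series (fun j => T j * u ^+ j) M)) / u).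
    apply/funext => M; rewrite /series /=.
    elim: M => [|M IH].
      by rewrite big_nat1 !big_geq // /T form_measure0 expr0; ring.
    rewrite big_nat_recr //= IH (big_nat_recr M.+1) //= !(big_nat_recr M) //=.
    by rewrite !exprS; field; rewrite gt_eqF.
  apply: cvgM; last exact: cvg_cst.
  apply: cvgB; first exact: cvg_cst.
  rewrite (_ : (1 - u) * P = P - u * P); last by ring.
  apply: cvgB; last by apply: cvgM; first exact: cvg_cst.
  by rewrite (cvg_shiftS (series (fun j => T j * u ^+ j))).
have cpow_abs (x : V) : cpow (padic_abs R (binary_form delta x)) N%:R =
    real_complex R (padic_abs R (binary_form delta x) ^+ N).
  rewrite /padic_abs; case: eqP => _; last by rewrite cpow_nat // invr_gt0 exprn_gt0 // ltr0n.
  by rewrite /cpow eqxx expr0n -[(N == 0)%N]negbK -lt0n N_gt0 rmorph0.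
rewrite /igusa_zeta /cintegral; congr Complex; last first.
  rewrite /Rintegral (eq_integral (fun=> 0%E)) ?integral0 // => x _.
  by rewrite cpow_abs.
rewrite /Rintegral.
rewrite (eq_integral (fun x => \sum_(j <oo) (u ^+ j * \1_(level_set j) x)%:E)%E); last first.
  by move=> x _; rewrite cpow_abs; apply/esym/series_EFin/padic_abs_series.
rewrite integral_nneseries //; last first.
- by move=> j x _; rewrite lee_fin mulr_ge0 ?indicE ?ler0n // exprn_ge0 // ltW.
- move=> j; apply/measurable_EFinP; apply: measurable_funM => //.
  by apply: measurable_indic; exact: measurable_level_set.
rewrite -[RHS]/(fine Z%:E) -(series_EFin cvgZ); congr fine.
apply: eq_eseriesr => j _; under eq_integral do rewrite EFinM.
rewrite ge0_integralZl_EFin ?exprn_ge0 ?ltW //.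
- rewrite integral_indic ?setIT ?measure_level_set //; exact: measurable_level_set.
- by apply/measurable_EFinP/measurable_indic; exact: measurable_level_set.
Qed.
End Value.
End Igusa.
End Haar.
End Padic.

(** * The generating function of the coefficients *)

Section PowerSeries.
Variable R : realType.

(** Each further delay multiplies the series by u and puts T_0 = 1 in front. *)
Lemma series_delay (T : nat -> R) (u Z : R) d : T 0 = 1 -> u != 1 ->
  series (fun j => T j * u ^+ j) @ \oo --> (1 - u * Z) / (1 - u) ->
  series (fun j => T (j - d)%N * u ^+ j) @ \oo --> (1 - u ^+ d.+1 * Z) / (1 - u).
Proof.
move=> T0 u1 TZ; have u1' : 1 - u != 0 by rewrite subr_eq0 eq_sym.
elim: d => [|d IH]; first rewrite expr1.
  have -> // : (fun j => T (j - 0)%N * u ^+ j) = (fun j => T j * u ^+ j).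
  by apply/funext => j; rewrite subn0.
rewrite -cvg_shiftS.
have -> : (1 - u ^+ d.+2 * Z) / (1 - u) = 1 + u * ((1 - u ^+ d.+1 * Z) / (1 - u)).
  by rewrite !exprS; field.
have -> : [sequence series (fun j => T (j - d.+1)%N * u ^+ j) M.+1]_M =
    (fun M => 1 + u * series (fun j => T (j - d)%N * u ^+ j) M).
  apply/funext => M; rewrite /series /= big_nat_recl // sub0n T0 expr0 mulr1.
  rewrite big_distrr /=; congr (_ + _); apply: eq_bigr => j _.
  by rewrite subSS exprS; ring.
by apply: cvgD; [exact: cvg_cst|apply: cvgM; [exact: cvg_cst|]].
Qed.

(** The coefficients of the power series of g divided by 1 - w^2. *)
Definition step2_sum (g : nat -> R) n := \sum_(i < (n./2).+1) g (n - i.*2)%N.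

Lemma step2_sumSS g n : step2_sum g n.+2 = g n.+2 + step2_sum g n.
Proof.
rewrite /step2_sum /= big_ord_recl /=; congr (_ + _).
Qed.

Lemma step2_sum_ge0 g n : (forall j, 0 <= g j) -> 0 <= step2_sum g n.
Proof. by move=> g0; apply: sumr_ge0. Qed.

(** The partial sums satisfy B_(M+2) = G_(M+2) + w^2 B_M, which bounds B_M by
    F / (1 - w^2) and so proves convergence; the limit then solves
    L = F + w^2 L. *)
Lemma series_step2_sum (g : nat -> R) (w F : R) :
  (forall j, 0 <= g j) -> 0 <= w -> w < 1 ->
  series (fun j => g j * w ^+ j) @ \oo --> F ->
  series (fun n => step2_sum g n * w ^+ n) @ \oo --> F / (1 - w ^+ 2).
Proof.
move=> g0 w0 w1 gF; set G := series _ in gF.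
set B := series _.
have w2 : 0 < 1 - w ^+ 2 by rewrite subr_gt0 expr_lt1.
have b0 n : 0 <= step2_sum g n * w ^+ n.
  by rewrite mulr_ge0 ?step2_sum_ge0 ?exprn_ge0.
have BE M : B M.+2 = G M.+2 + w ^+ 2 * B M.
  rewrite /B /G /series /=; elim: M => [|M IH].
    by rewrite !(big_nat_recr 1) // !big_nat1 big_geq //= /step2_sum !big_ord1 /=; ring.
  rewrite big_nat_recr //= IH [in RHS]big_nat_recr //= [X in _ = _ + _ * X]big_nat_recr //=.
  by rewrite step2_sumSS !exprS; ring.
have Gle M : G M <= F.
  have -> : F = limn G by apply/esym/cvg_lim.
  apply: nondecreasing_cvgn_le; last by apply/cvg_ex; exists F.
  apply: nondecreasing_series => n _ _; by rewrite mulr_ge0 ?exprn_ge0.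
have Bnd : nondecreasing_seq B by apply: nondecreasing_series => n _ _.
have Bub M : B M <= F / (1 - w ^+ 2).
  rewrite ler_pdivlMr // mulrBr mulr1 lerBlDr.
  apply: (le_trans (Bnd M M.+2 _)); first by rewrite -addn2 leq_addr.
  by rewrite BE [B M * _]mulrC lerD2r Gle.
have cvgB : cvgn B.
  apply: nondecreasing_is_cvgn => //; exists (F / (1 - w ^+ 2)) => _ [M _ <-]; exact: Bub.
have BL := cvgB; set L := limn B in BL.
suff -> : F / (1 - w ^+ 2) = L by [].
have E : (fun M => B M.+2) = (fun M => G M.+2 + w ^+ 2 * B M) by apply/funext.
have lim1 : (fun M => B M.+2) @ \oo --> L.
  by rewrite (cvg_shiftS (fun M => B M.+1)) cvg_shiftS.
have lim2 : (fun M => B M.+2) @ \oo --> F + w ^+ 2 * L.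
  rewrite E; apply: cvgD; first by rewrite (cvg_shiftS (fun M => G M.+1)) cvg_shiftS.
  by apply: cvgM; first exact: cvg_cst.
have LE := cvg_unique (@norm_hausdorff _ _) lim1 lim2.
apply: (mulIf (lt0r_neq0 w2)); rewrite divfK ?gt_eqF //.
by rewrite mulrBr mulr1 {1}LE; ring.
Qed.

Section Coefficients.
Variables (p : nat) (p_gt1 : (1 < p)%N) (T : nat -> R) (d : nat).
Hypothesis T0 : T 0 = 1.
Hypothesis T_ge : forall j, p%:R^-1 <= p%:R ^+ j * T j.
Local Notation P := (p%:R : R).

(** The numbers S_j.  Truncated subtraction makes T_(j-d) equal to T_0 = 1 for
    j < d. *)
Definition delayed j : R := P ^+ j * T (j - d)%N.
Definition step_coef j : R := (delayed j - P ^- j.+1) / (1 - P^-1).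
(** The number of subalgebras of index p^n, once the zeta formula is known. *)
Definition subalg_coef n : R := P ^+ n * step2_sum step_coef n.

Let P_gt1 : 1 < P. Proof. by rewrite ltr1n. Qed.
Let P_gt0 : 0 < P. Proof. exact: lt_trans P_gt1. Qed.
Let P_neq0 : P != 0. Proof. by rewrite gt_eqF. Qed.
Let Pm1_neq0 : P - 1 != 0. Proof. by rewrite gt_eqF // subr_gt0. Qed.
Let q_lt1 : P^-1 < 1. Proof. by rewrite invf_lt1. Qed.

Lemma delayed_split j : delayed j = P ^+ (minn j d) * (P ^+ (j - d) * T (j - d)%N).
Proof. by rewrite mulrA -exprD; congr (_ ^+ _ * _); lia. Qed.

Lemma delayed_ge j : P^-1 <= delayed j.
Proof.
rewrite delayed_split; apply: (le_trans (T_ge (j - d))).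
by rewrite ler_peMl ?exprn_ege1 ?ltW // (lt_le_trans _ (T_ge _)) // invr_gt0.
Qed.

Lemma step_coef0 : step_coef 0 = 1.
Proof.
rewrite /step_coef /delayed expr0 sub0n T0 expr1 mulr1 divff //.
by rewrite subr_eq0 eq_sym lt_eqF.
Qed.

(** For j > 0 the subtracted term q^(j+1) is at most q times S_j, as S_j >= q; for
    j = 0 both sides are 1. *)
Lemma step_coef_ge j : delayed j <= step_coef j.
Proof.
case: j => [|j]; first by rewrite step_coef0 /delayed expr0 sub0n T0 mul1r.
rewrite /step_coef ler_pdivlMr ?subr_gt0 // mulrBr mulr1 lerD2l lerN2.
apply: (@le_trans _ _ (P^-1 * P^-1)).
  rewrite -exprVn -expr2; apply: ler_wiXn2l; rewrite ?invr_ge0 ?ltW //.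
by rewrite ler_wpM2r ?delayed_ge // invr_ge0 ltW.
Qed.

Lemma step_coef_le j : step_coef j <= (1 - P^-1)^-1 * delayed j.
Proof.
rewrite mulrC /step_coef ler_wpM2r //; first by rewrite invr_ge0 subr_ge0 ltW.
by rewrite gerBl invr_ge0 exprn_ge0 // ltW.
Qed.

Lemma step_coef_ge0 j : 0 <= step_coef j.
Proof.
apply: le_trans (step_coef_ge j); apply: le_trans (delayed_ge j).
by rewrite invr_ge0 ltW.
Qed.

Lemma subalg_coef_ge0 n : 0 <= subalg_coef n.
Proof. by rewrite mulr_ge0 ?exprn_ge0 ?step2_sum_ge0 ?ltW //; exact: step_coef_ge0. Qed.

Lemma subalg_coef0 : subalg_coef 0 = 1.
Proof. by rewrite /subalg_coef /step2_sum big_ord1 expr0 mul1r step_coef0. Qed.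

(** The identity behind the cancellation of the pole at u = 1 is
    1 / ((1 - q w) (1 - w)) - 1 / ((1 - w^2) (1 - q))
      = - q (1 - u) / ((1 - q) (1 - w^2) (1 - q w)),
    where u = p w. *)
Lemma subalg_coef_series N Z : (2 < N)%N ->
  let t := P ^- N in let u := P ^- (N - 2) in
  series (fun j => T j * u ^+ j) @ \oo --> (1 - u * Z) / (1 - u) ->
  series (fun n => subalg_coef n * t ^+ n) @ \oo -->
    (1 - t)^-1 * (1 - P * t)^-1 * (1 - P ^+ 2 * t)^-1
    - Z * (1 - P ^+ 2 * t ^+ 2)^-1 * (1 - P ^+ 2 * t)^-1 * (P ^+ 2 * t) ^+ d.+1
      * (1 - P^-1)^-1.
Proof.
move=> N2 t u TZ.
have uE : u = P ^+ 2 * t.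
  rewrite /u /t; have {2}-> : N = (2 + (N - 2))%N by lia.
  by rewrite exprD invfM mulrA divff ?mul1r // expf_neq0.
have small k : (0 < k)%N -> 0 < P ^- k < 1.
  by move=> k0; rewrite invr_gt0 exprn_gt0 // invf_lt1 ?exprn_gt0 // exprn_egt1 // -lt0n.
have /andP[u0 u1] : 0 < u < 1 by apply: small; lia.
have t0 : 0 < t by rewrite invr_gt0 exprn_gt0.
pose w := P * t.
have w0 : 0 < w by rewrite mulr_gt0.
have wu : P * w = u by rewrite uE /w; ring.
have tw : t <= w by rewrite ler_peMl // ltW.
have wu' : w <= u by rewrite -wu ler_peMl // ltW.
have w1 : w < 1 := le_lt_trans wu' u1.
have lim1 : series (fun j => delayed j * w ^+ j) @ \oo --> (1 - u ^+ d.+1 * Z) / (1 - u).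
  have <- : (fun j => T (j - d)%N * u ^+ j) = (fun j => delayed j * w ^+ j).
    by apply/funext => j; rewrite /delayed -wu exprMn; ring.
  by apply: series_delay => //; rewrite lt_eqF.
have lim2 : series (fun j => P ^- j.+1 * w ^+ j) @ \oo --> P^-1 / (1 - t).
  have -> : (fun j => P ^- j.+1 * w ^+ j) = geometric P^-1 t.
    apply/funext => j; rewrite /= exprS invfM -mulrA; congr (_ * _).
    by rewrite /w exprMn mulrA mulVf ?mul1r // expf_neq0.
  by apply: cvg_geometric_series; rewrite ger0_norm ?ltW // (le_lt_trans tw).
have lim3 : series (fun j => step_coef j * w ^+ j) @ \oo -->
    ((1 - u ^+ d.+1 * Z) / (1 - u) - P^-1 / (1 - t)) / (1 - P^-1).
  have -> : series (fun j => step_coef j * w ^+ j) = (fun M =>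
     (series (fun j => delayed j * w ^+ j) M - series (fun j => P ^- j.+1 * w ^+ j) M)
       / (1 - P^-1)).
    apply/funext => M; rewrite /series /= -sumrB mulr_suml; apply: eq_bigr => j _.
    by rewrite /step_coef; ring.
  by apply: cvgM; [exact: cvgB|exact: cvg_cst].
have lim4 := series_step2_sum step_coef_ge0 (ltW w0) w1 lim3.
have -> : (fun n => subalg_coef n * t ^+ n) = (fun n => step2_sum step_coef n * w ^+ n).
  by apply/funext => n; rewrite /subalg_coef /w exprMn; ring.
suff -> : (1 - t)^-1 * (1 - P * t)^-1 * (1 - P ^+ 2 * t)^-1
    - Z * (1 - P ^+ 2 * t ^+ 2)^-1 * (1 - P ^+ 2 * t)^-1 * (P ^+ 2 * t) ^+ d.+1
      * (1 - P^-1)^-1 =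
    ((1 - u ^+ d.+1 * Z) / (1 - u) - P^-1 / (1 - t)) / (1 - P^-1) / (1 - w ^+ 2).
  exact: lim4.
rewrite -uE; have -> : P ^+ 2 * t ^+ 2 = w ^+ 2 by rewrite /w exprMn.
rewrite -/w; move: (u ^+ d.+1) => U.
have tE : t = P^-1 * w by rewrite /w mulrA mulVf // mul1r.
have d1 : 1 - w != 0 by rewrite gt_eqF // subr_gt0.
have d2 : 1 + w != 0 by rewrite gt_eqF // addr_gt0.
have d3 : 1 - P * w != 0 by rewrite wu gt_eqF // subr_gt0.
have d4 : P - w != 0 by rewrite gt_eqF // subr_gt0 (lt_trans w1).
have -> : 1 - w ^+ 2 = (1 - w) * (1 + w) by ring.
by rewrite -wu tE; field; rewrite P_neq0 Pm1_neq0 d1 d2 d3 d4.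
Qed.
End Coefficients.
End PowerSeries.

(** * Dirichlet series with nonnegative coefficients *)

Section Dirichlet.
Variable R : realType.

Lemma nneseries_series (a : nat -> R) (l : R) : (forall n, 0 <= a n) ->
  (\sum_(n <oo) (a n)%:E = l%:E)%E -> series a @ \oo --> l.
Proof.
move=> a0 al.
have : (fun n => \sum_(0 <= i < n) (a i)%:E)%E @ \oo --> l%:E.
  by rewrite -al; apply: is_cvg_nneseries => n _ _; rewrite lee_fin.
by move/fine_cvg; apply: cvg_trans; under eq_fun do rewrite /= sumEFin.
Qed.

Lemma series_le_lim (a : nat -> R) (l : R) M : (forall n, 0 <= a n) ->
  series a @ \oo --> l -> series a M <= l.
Proof.
move=> a0 al; have <- : limn (series a) = l by apply/cvg_lim.
apply: nondecreasing_cvgn_le; last by apply/cvg_ex; exists l.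
exact: nondecreasing_series.
Qed.

Section Uniqueness.
Variables (c d s : nat -> R) (N0 : nat).
Hypotheses (c0 : forall m, 0 <= c m) (d0 : forall m, 0 <= d m).
Hypothesis c_sum : forall N, (N0 <= N)%N -> series (fun m => c m / m%:R ^+ N) @ \oo --> s N.
Hypothesis d_sum : forall N, (N0 <= N)%N -> series (fun m => d m / m%:R ^+ N) @ \oo --> s N.

(** Remove the equal terms of index below m and multiply by m^N: the terms of
    index above m are then at most (m / (m+1))^(N - N0) times a constant, and
    vanish as N tends to infinity. *)
Lemma dirichlet_coef_le m : (0 < m)%N -> (forall i, (i < m)%N -> c i = d i) -> c m <= d m.
Proof.
move=> m0 eq_lt; set K := m%:R ^+ N0 * s N0.
have term_ge0 (a : nat -> R) N : (forall m, 0 <= a m) -> forall i, 0 <= a i / i%:R ^+ N.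
  by move=> a0 i; rewrite divr_ge0 ?exprn_ge0.
pose x : R := m%:R / m.+1%:R.
have step k : c m <= d m + x ^+ k * K.
  set N := (N0 + k)%N; have N0N : (N0 <= N)%N by rewrite leq_addr.
  have mN : 0 < m%:R ^+ N :> R by rewrite exprn_gt0 // ltr0n.
  suff : c m / m%:R ^+ N <= d m / m%:R ^+ N + m.+1%:R ^- k * s N0.
    rewrite ler_pdivrMr // mulrDl divfK ?gt_eqF // /K /x => /le_trans; apply.
    by rewrite lerD2l /N exprMn exprVn exprD; rewrite le_eqVlt; apply/orP; left; apply/eqP; ring.
  have le_c : series (fun m => c m / m%:R ^+ N) m.+1 <= s N.
    by apply: series_le_lim; [exact: term_ge0|exact: c_sum].
  have le_d : s N <= series (fun m => d m / m%:R ^+ N) m.+1 + m.+1%:R ^- k * s N0.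
    have lim := d_sum N0N; have <- := cvg_lim (@norm_hausdorff _ _) lim.
    apply: limr_le; first by apply/cvg_ex; exists (s N).
    exists m.+1 => // M /= mM.
    rewrite /series /= (big_cat_nat (n := m.+1)) //= lerD2l.
    apply: (@le_trans _ _ (m.+1%:R ^- k * \sum_(m.+1 <= i < M) d i / i%:R ^+ N0)).
      rewrite big_distrr /=; apply: ler_sum_nat => i /andP[mi _].
      have i0 : 0 < i%:R :> R by rewrite ltr0n (leq_trans _ mi).
      rewrite mulrCA; apply: ler_wpM2l => //; rewrite /N exprD invfM mulrC.
      rewrite ler_wpM2r ?invr_ge0 ?exprn_ge0 //.
      rewrite lef_pV2 ?posrE ?exprn_gt0 // ?ltr0n //.
      by apply: lerXn2r; rewrite ?nnegrE ?ler0n // ler_nat.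
    rewrite ler_wpM2l ?invr_ge0 ?exprn_ge0 //.
    apply: (@le_trans _ _ (series (fun i => d i / i%:R ^+ N0) M)); last first.
      by apply: series_le_lim; [exact: term_ge0|exact: d_sum].
    rewrite /series /= [leRHS](big_cat_nat (n := m.+1)) //= lerDr.
    by apply: sumr_ge0 => i _; exact: term_ge0.
  have := le_trans le_c le_d; rewrite /series /= !big_nat_recr //= -addrA.
  suff -> : \sum_(0 <= i < m) c i / i%:R ^+ N = \sum_(0 <= i < m) d i / i%:R ^+ N.
    by rewrite lerD2l.
  by apply: eq_big_nat => i /andP[_ im]; rewrite eq_lt.
have limx : (fun k => d m + x ^+ k * K) @ \oo --> d m.
  rewrite -[X in _ --> X]addr0 -(mul0r K); apply: cvgD; first exact: cvg_cst.
  apply: cvgM; last exact: cvg_cst.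
  apply: cvg_expr; rewrite ger0_norm ?divr_ge0 // ltr_pdivrMr ?ltr0n // mul1r ltr_nat //.
have <- := cvg_lim (@norm_hausdorff _ _) limx.
by apply: limr_ge; [apply/cvg_ex; exists (d m)|exact: nearW].
Qed.
End Uniqueness.

Lemma dirichlet_coef_eq (c d s : nat -> R) N0 :
  (forall m, 0 <= c m) -> (forall m, 0 <= d m) -> c 0 = d 0 ->
  (forall N, (N0 <= N)%N -> series (fun m => c m / m%:R ^+ N) @ \oo --> s N) ->
  (forall N, (N0 <= N)%N -> series (fun m => d m / m%:R ^+ N) @ \oo --> s N) ->
  c =1 d.
Proof.
move=> c0 d0 cd0 c_sum d_sum; elim/ltn_ind => -[//|m] IH.
apply/eqP; rewrite eq_le; apply/andP; split.
  exact: (dirichlet_coef_le c0 d0 c_sum d_sum).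
by apply: (dirichlet_coef_le d0 c0 d_sum c_sum) => // i /IH.
Qed.

Lemma esum_cst_finite (T : choiceType) (D : set T) (x : R) : 0 < x ->
  (\esum_(i in D) x%:E < +oo)%E -> finite_set D.
Proof.
move=> x0 fin; apply: contrapT => infD.
have : (\esum_(i in D) x%:E = +oo)%E.
  apply/eqyP => A A0; have [B BD Bcard] := infinite_set_fset (Num.truncn (A / x)).+1 infD.
  apply: esum_ge; exists [set` B]; first by split=> //; exact: finite_fset.
  rewrite fsbig_finite //= set_fsetK sumEFin lee_fin big_const_seq count_predT iter_addr_0.
  rewrite -mulr_natr -ler_pdivrMl // mulrC; apply/ltW/(lt_le_trans (truncnS_gt _)).
  by rewrite ler_nat.
by move=> E; rewrite E in fin.
Qed.

Section Fibres.
Variables (T : choiceType) (D : set T) (f : T -> nat).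
Definition fibre m : set T := [set x | D x /\ f x = m].

Lemma esum_fibres (g : nat -> R) : (forall m, 0 <= g m) ->
  (\esum_(x in D) (g (f x))%:E = \sum_(m <oo) \esum_(x in fibre m) (g m)%:E)%E.
Proof.
move=> g0; rewrite nneseries_esumT; last by move=> m; apply: esum_ge0 => x _; rewrite lee_fin.
have {1}-> : D = \bigcup_(m in setT) fibre m.
  by apply/seteqP; split=> [x Dx|x [m _ []]] //; exists (f x).
rewrite esum_bigcupT.
- by apply: eq_esum => m _; apply: eq_esum => x [_ ->].
- by move=> i j _ _ [x [[_ <-] [_ <-]]].
- by move=> x; rewrite lee_fin.
Qed.

Definition fibre_card m : R := #|` fset_set (fibre m)|%:R.

(** The fibre over m contributes the constant m^-N for each of its members, so a
    finite total forces the fibre to be finite. *)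
Lemma fibre_card_series (N : nat) (s : R) : (forall x, D x -> (0 < f x)%N) ->
  (\esum_(x in D) ((f x)%:R ^- N)%:E = s%:E)%E ->
  (forall m, finite_set (fibre m)) /\
  series (fun m => fibre_card m / m%:R ^+ N) @ \oo --> s.
Proof.
move=> f0; rewrite (esum_fibres (g := fun m => m%:R ^- N)); last first.
  by move=> m; rewrite invr_ge0 exprn_ge0.
move=> sE.
have fin m : finite_set (fibre m).
  case: m => [|m].
    suff -> : fibre 0 = set0 by [].
    by apply/seteqP; split=> // x [/f0 + fx]; rewrite fx.
  apply: (@esum_cst_finite _ _ (m.+1%:R ^- N)).
    by rewrite invr_gt0 exprn_gt0 // ltr0n.
  apply: (@le_lt_trans _ _ s%:E); last exact: ltry.
  pose U k := (\esum_(x in fibre k) ((k%:R : R) ^- N)%:E)%E.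
  have U0 k : (0 <= U k)%E by apply: esum_ge0 => x _; rewrite lee_fin.
  have h := @nneseries_lim_ge R U xpredT 0 m.+2 (fun k _ _ => U0 k).
  rewrite -sE; apply: (le_trans _ h); rewrite big_nat_recr //= leeDr //.
  by apply: sume_ge0 => k _.
split=> //; apply: nneseries_series => [m|].
  by rewrite divr_ge0 ?exprn_ge0.
rewrite -sE; apply: eq_eseriesr => m _.
rewrite esum_fset //.
rewrite fsbig_finite //= sumEFin big_const_seq count_predT iter_addr_0.
by rewrite mulr_natl.
Qed.

Lemma card_fset_set_le M :
  (forall m, finite_set (fibre m)) ->
  #|` fset_set [set x | D x /\ (f x <= M)%N]|%:R = \sum_(m < M.+1) fibre_card m.
Proof.
move=> fin; set G := [set x | _].
have finG : finite_set G.
  apply: (@sub_finite_set _ _ (\bigcup_(m in `I_M.+1) fibre m)).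
    by move=> x [Dx fx]; exists (f x).
  by apply: bigcup_finite => [|m _]; [exact: finite_II|exact: fin].
rewrite -natr_sum; congr _%:R; rewrite -sum1_size.
rewrite [LHS]big_seq (eq_bigr (fun x => \sum_(m < M.+1) (f x == m :> nat))%N); last first.
  move=> x; rewrite in_fset_set // inE => -[_ fx].
  rewrite (bigD1 (Ordinal (fx : (f x < M.+1)%N))) //= eqxx big1 // => i.
  by apply: contraNeq; rewrite eqb0 negbK => /eqP fi; apply/eqP/val_inj.
rewrite -big_seq exchange_big /=; apply: eq_bigr => m _.
rewrite -big_mkcond /= -sum1_size -[LHS]big_filter; apply: perm_big.
apply: uniq_perm; rewrite ?filter_uniq ?fset_uniq // => x.
rewrite mem_filter !in_fset_set //; apply/andP/idP; rewrite !inE.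
  by move=> [/eqP fx [Dx _]].
by move=> [Dx fx]; rewrite fx eqxx; split=> //; split; rewrite // fx -ltnS.
Qed.
End Fibres.
End Dirichlet.


Section PrimePowers.
Variables (R : realType) (p : nat) (p_prime : prime p) (a : nat -> R).
Hypothesis a_ge0 : forall n, 0 <= a n.
Let p0 : (0 < p)%N := prime_gt0 p_prime.
Let p1 : (1 < p)%N := prime_gt1 p_prime.

(** The Dirichlet coefficients of the function s |-> sum_n a_n p^(-n s). *)
Definition prime_power_coef m : R := if m == (p ^ logn p m)%N then a (logn p m) else 0.

Lemma prime_power_coefX n : prime_power_coef (p ^ n)%N = a n.
Proof. by rewrite /prime_power_coef pfactorK // eqxx. Qed.

Lemma prime_power_coef_ge0 m : 0 <= prime_power_coef m.
Proof. by rewrite /prime_power_coef; case: ifP. Qed.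

Lemma prime_power_series N (s : R) : series (fun n => a n * (p%:R ^- N) ^+ n) @ \oo --> s ->
  series (fun m => prime_power_coef m / m%:R ^+ N) @ \oo --> s.
Proof.
move=> /series_EFin sE.
have q0 : 0 <= p%:R ^- N :> R by rewrite invr_ge0 exprn_ge0.
apply: nneseries_series => [m|].
  by rewrite divr_ge0 ?prime_power_coef_ge0 ?exprn_ge0.
rewrite -sE !nneseries_esumT; last 2 first.
- by move=> n; rewrite lee_fin mulr_ge0 ?exprn_ge0.
- by move=> m; rewrite lee_fin divr_ge0 ?prime_power_coef_ge0 ?exprn_ge0.
rewrite -[LHS](_ : \esum_(m in range (fun n => p ^ n)%N) (prime_power_coef m / m%:R ^+ N)%:E = _)%E.
  rewrite esum_image; last by move=> i j _ _; apply: expnI.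
  by apply: eq_esum => n _; rewrite prime_power_coefX natrX -exprM mulnC exprM exprVn.
rewrite esum_mkcond; apply: eq_esum => m _; case: ifPn => //; rewrite notin_setE => h.
rewrite /prime_power_coef; case: eqP => [mp|_]; last by rewrite mul0r.
by case: h; exists (logn p m).
Qed.

Lemma sum_prime_power n :
  \sum_(m < (p ^ n).+1) prime_power_coef m = \sum_(i < n.+1) a i.
Proof.
have E (m : 'I_(p ^ n).+1) : prime_power_coef m =
    \sum_(i < n.+1) (if (p ^ i == m)%N then a i else 0).
  rewrite /prime_power_coef; case: eqP => [mp|nmp]; last first.
    rewrite big1 // => i _; case: eqP => // im; case: nmp.
    by rewrite -im pfactorK.
  have ln : (logn p m < n.+1)%N.
    by rewrite ltnS -(leq_exp2l _ _ p1) -mp -ltnS.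
  rewrite (bigD1 (Ordinal ln)) //= -mp eqxx big1 ?addr0 // => i.
  move=> /eqP ni; case: eqP => // im; case: ni; apply/val_inj => /=.
  by rewrite -im pfactorK.
rewrite (eq_bigr _ (fun m _ => E m)) exchange_big /=; apply: eq_bigr => i _.
have lt_i : (p ^ i < (p ^ n).+1)%N by rewrite ltnS leq_exp2l // -ltnS.
rewrite (bigD1 (Ordinal lt_i)) //= eqxx big1 ?addr0 // => m.
by rewrite eq_sym => /eqP nm; case: eqP => // im; case: nm; apply/val_inj.
Qed.
End PrimePowers.

(** * Growth of the densities and of the coefficients *)

Section PadicResidues.
Variables (p : nat) (p_prime : prime p).
Let p0 : (0 < p)%N := prime_gt0 p_prime.

Lemma residue_nat n j : residue (n%:R : padic p) j = (n%:Z %% (p ^ j)%:Z)%Z.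
Proof.
elim: n => [|n IH]; first by rewrite residue_0 mod0z.
by rewrite -natr1 /= IH modzDm -PoszD addn1.
Qed.

Lemma residue_mulX k (x : padic p) j i : (j <= i)%N ->
  ndvdz (p ^ j) (residue (p%:R ^+ k * x) j - (p ^ k)%:Z * residue x i).
Proof.
move=> ji; rewrite -natrX /= residue_nat modzMml.
rewrite /ndvdz -eqz_mod_dvd modz_mod eqz_mod_dvd -mulrBr.
apply: ndvdz_mull; rewrite -ndvdzN // opprB; exact: ndvdz_residueB.
Qed.

(** The exponent is j.+1 because the residue modulo p^0 carries no information. *)
Lemma residue_unit (u : padic p) j : padic_unit u -> ~~ ndvdz p (residue u j.+1).
Proof.
move=> [v uv]; apply/negP => pu.
have u1 : residue u 1 = 0.
  by rewrite (residue_mod_le u (ltn0Sn j)) expn1; apply/dvdz_mod0P.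
have : residue (u * v) 1 = 0 by rewrite /= u1 mul0r mod0z.
by rewrite uv /= expn1 modz_small // ltz_nat prime_gt1.
Qed.

(** The quotient has the residues (w mod p^(n+1)) / p. *)
Lemma residue_div (w : padic p) : residue w 1 = 0 -> exists z, w = p%:R * z.
Proof.
move=> w1; have pz : p%:Z != 0 by rewrite eqz_nat -lt0n.
have wE n : residue w n.+1 = p%:Z * (residue w n.+1 %/ p%:Z)%Z.
  rewrite mulrC divzK //; apply/dvdz_mod0P.
  by move: w1; rewrite (residue_mod_le w (ltn0Sn n)) expn1.
have coh n : (residue w n.+1 %/ p%:Z)%Z =
    ((residue w n.+2 %/ p%:Z)%Z %% (p ^ n)%:Z)%Z.
  apply: (mulfI pz); rewrite -wE (residueP w n.+1) {1}(wE n.+1) expnS PoszM.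
  by rewrite -mulz_modr // ltz_nat.
exists (Padic coh); apply: padic_eq => n.
rewrite /= residue_nat modzMml -wE.
exact: residueP.
Qed.

Lemma residue_nonsquare (rho : padic p) j : ~ square_mod_p rho ->
  forall y : int, ~~ ndvdz p (y ^+ 2 - residue rho j.+1).
Proof.
move=> ns y; apply/negP => py; apply: ns.
have w1 : residue (rho - padic_of_int p y ^+ 2) 1 = 0.
  rewrite expr2 /= modzMm modzDmr -modzDmr modzNm modzDmr.
  rewrite (residue_mod_le rho (ltn0Sn j)) modzDml.
  by apply/dvdz_mod0P; rewrite -ndvdzN /ndvdz in py; rewrite expn1; move: py; rewrite opprB expr2.
have [z wz] := residue_div w1.
by exists (padic_of_int p y), z; rewrite -wz addrC subrK.
Qed.
End PadicResidues.

Section FormGrowth.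
Variables (R : realType) (p : nat) (p_prime : prime p) (p_odd : (2 < p)%N).
Let p0 : (0 < p)%N := prime_gt0 p_prime.
Local Notation P := (p%:R : R).
Let P_gt0 : 0 < P. Proof. by rewrite ltr0n. Qed.

Definition density (delta : padic p) j : R := P ^+ j * form_measure R delta j.

Lemma densityE delta j : density delta j = (nb_sol p j (residue delta j))%:R / (p ^ j)%:R.
Proof.
have Pj : P ^+ j != 0 by rewrite expf_neq0 // gt_eqF.
by rewrite /density /form_measure mul2n -addnn expnD natrM !natrX; field.
Qed.

Lemma density_ge delta j : P^-1 <= density delta j.
Proof.
rewrite densityE ler_pdivlMr ?ltr0n ?expn_gt0 ?p0 // ler_pdivrMl // mulrC -natrM ler_nat.
exact: nb_sol_ge.
Qed.

Lemma density_le_aniso (rho : padic p) k j : padic_unit rho ->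
  odd k \/ ~ square_mod_p rho -> density (p%:R ^+ k * rho) j <= P ^+ k.
Proof.
move=> u_rho hk; rewrite densityE ler_pdivrMr ?ltr0n ?expn_gt0 ?p0 //.
have -> : P ^+ k * (p ^ j)%:R = (p ^ (j + k))%:R by rewrite -natrX -natrM -expnD addnC.
rewrite ler_nat.
rewrite (nb_sol_congr (residue_mulX k rho (leqnSn j))).
apply: nb_sol_le_aniso => //; first exact: residue_unit.
by case: hk => [|ns]; [left|right; exact: residue_nonsquare].
Qed.

Lemma nb_sol_square_residue (u : padic p) m j :
  nb_sol p j (residue ((p%:R ^+ m * u) ^+ 2) j) =
  nb_sol p j (((p ^ m)%:Z * residue u j.+1) ^+ 2).
Proof.
apply: nb_sol_congr; have h := residue_mulX m u (leqnSn j).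
move: h; rewrite expr2 -[residue (_ * (_ * _)) _]/(_ %% _)%Z.
set x := residue (p%:R ^+ m * u) j; set y := (p ^ m)%:Z * residue u j.+1 => xy.
rewrite /ndvdz -eqz_mod_dvd modz_mod eqz_mod_dvd -[x * x]expr2 subr_sqr mulrC.
exact: ndvdz_mull.
Qed.

Lemma density_square (u : padic p) m j : padic_unit u ->
  (p * (4 * m.+1))%:R^-1 * j.+1%:R <= density ((p%:R ^+ m * u) ^+ 2) j <= P ^+ m * j.+1%:R.
Proof.
move=> uu; rewrite densityE nb_sol_square_residue.
have uv := residue_unit p_prime j uu.
have pj : 0 < (p ^ j)%:R :> R by rewrite ltr0n expn_gt0 p0.
rewrite ler_pdivlMr // ler_pdivrMr // -mulrA ler_pdivrMl ?ltr0n ?muln_gt0 ?p0 //.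
rewrite -natrX -!natrM !ler_nat [X in (_ <= X)%N && _]mulnC nb_sol_square_ge //=.
rewrite [X in (_ <= X)%N]mulnAC -expnD addnC mulnC; exact: nb_sol_square_le.
Qed.

Lemma padic_unitX (u : padic p) n : padic_unit u -> padic_unit (u ^+ n).
Proof. by move=> [v uv]; exists (v ^+ n); rewrite -exprMn uv expr1n. Qed.

(** The exponent is 0 when the form is anisotropic and 1 when it splits. *)
Lemma density_bounds star k delta : has_type star k delta ->
  exists c C : R, [/\ 0 < c, 0 < C & forall j,
    c * j.+1%:R ^+ (growth_exponent star k).-1 <= density delta j
    <= C * j.+1%:R ^+ (growth_exponent star k).-1].
Proof.
move=> ht.
have aniso rho : padic_unit rho -> odd k \/ ~ square_mod_p rho ->
    delta = p%:R ^+ k * rho -> (growth_exponent star k).-1 = 0%N ->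
    exists c C : R, [/\ 0 < c, 0 < C & forall j,
      c * j.+1%:R ^+ (growth_exponent star k).-1 <= density delta j
      <= C * j.+1%:R ^+ (growth_exponent star k).-1].
  move=> u_rho hk -> ->; exists P^-1, (P ^+ k); split; rewrite ?invr_gt0 ?exprn_gt0 //.
  by move=> j; rewrite expr0 !mulr1 density_ge density_le_aniso.
case: star ht aniso => [[u uu ->]|[rho [u_rho ns ->]]] aniso; last first.
  by apply: aniso u_rho _ _ _ => //; right.
case: (boolP (odd k)) aniso => [ok|ek] aniso.
  by apply: (aniso (u ^+ 2)) => //; [exact: padic_unitX|left|rewrite /= ok].
rewrite /= (negPf ek).
have <- : k./2.*2 = k by rewrite -[RHS]odd_double_half (negPf ek).
rewrite -muln2 exprM -exprMn; set m := k./2.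
exists (p * (4 * m.+1))%:R^-1, (P ^+ m); split.
- by rewrite invr_gt0 ltr0n !muln_gt0 p0.
- by rewrite exprn_gt0.
- by move=> j; exact: density_square.
Qed.
End FormGrowth.

Section CoefficientGrowth.
Variable R : realType.

(** Induction in steps of 2, since (n+2)^(e+1) - n^(e+1) <= 4 (n+3)^e for e <= 1. *)
Lemma step2_sum_lower (g : nat -> R) c e : 0 <= c -> (e <= 1)%N ->
  (forall j, c * j.+1%:R ^+ e <= g j) ->
  forall n, c * n%:R ^+ e.+1 <= 4 * step2_sum g n.
Proof.
move=> c0 e1 cg n.
have g0 j : 0 <= g j by apply: le_trans (cg j); rewrite mulr_ge0 ?exprn_ge0.
suff : c * n%:R ^+ e.+1 <= 4 * step2_sum g n /\
       c * n.+1%:R ^+ e.+1 <= 4 * step2_sum g n.+1 by case.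
elim: n => [|n [IH1 IH2]]; split=> //.
- by rewrite expr0n mulr0 mulr_ge0 // step2_sum_ge0.
- rewrite /step2_sum big_ord1 expr1n mulr1; have := cg 1; have := g0 1.
  case: e {cg} e1 => [|[|//]] _; rewrite ?expr0 ?expr1; lra.
- rewrite step2_sumSS mulrDr; have := cg n.+2; move: IH1.
  have n0 : 0 <= n%:R :> R by [].
  have -> : n.+3%:R = n%:R + 3 :> R by rewrite -addn3 natrD.
  have -> : n.+2%:R = n%:R + 2 :> R by rewrite -addn2 natrD.
  case: e {cg IH2} e1 => [|[|//]] _; rewrite ?expr0 ?expr1; nra.
Qed.

Lemma step2_sum_upper (g : nat -> R) C e : 0 <= C ->
  (forall j, g j <= C * j.+1%:R ^+ e) ->
  forall n, step2_sum g n <= C * n.+1%:R ^+ e.+1.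
Proof.
move=> C0 gC n; rewrite /step2_sum.
apply: (@le_trans _ _ (\sum_(i < (n./2).+1) C * n.+1%:R ^+ e)).
  apply: ler_sum => i _; apply: (le_trans (gC _)); rewrite ler_wpM2l //.
  by apply: lerXn2r; rewrite ?nnegrE ?ler0n // ler_nat ltnS leq_subr.
rewrite sumr_const card_ord -[leLHS]mulr_natr -mulrA ler_wpM2l // exprSr.
rewrite ler_wpM2l ?exprn_ge0 // ler_nat ltnS; lia.
Qed.

Section Bounds.
Variables (p : nat) (p_gt1 : (1 < p)%N) (T : nat -> R) (d e : nat) (c C : R).
Hypothesis T0 : T 0 = 1.
Hypothesis T_ge : forall j, p%:R^-1 <= p%:R ^+ j * T j.
Hypotheses (e1 : (e <= 1)%N) (c0 : 0 < c) (C0 : 0 < C).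
Hypothesis T_bounds : forall j,
  c * j.+1%:R ^+ e <= p%:R ^+ j * T j <= C * j.+1%:R ^+ e.
Local Notation P := (p%:R : R).
Let P_gt1 : 1 < P. Proof. by rewrite ltr1n. Qed.
Let P_gt0 : 0 < P. Proof. exact: lt_trans P_gt1. Qed.

(** Delaying by d costs a factor (d+1)^e, because j + 1 <= (d+1) (j-d+1). *)
Lemma step_coef_lower j : c / d.+1%:R ^+ e * j.+1%:R ^+ e <= step_coef p T d j.
Proof.
apply: le_trans (step_coef_ge p_gt1 d T0 T_ge j).
have /andP[lo _] := T_bounds (j - d); rewrite delayed_split //.
apply: (le_trans _ (le_trans lo _)); last first.
  by rewrite ler_peMl ?exprn_ege1 ?ltW // (lt_le_trans _ (T_ge _)) // invr_gt0.
rewrite -mulrA ler_wpM2l ?(ltW c0) // ler_pdivrMl ?exprn_gt0 ?ltr0n // -exprMn -natrM.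
apply: lerXn2r; rewrite ?nnegrE ?ler0n // ler_nat; nia.
Qed.

Lemma step_coef_upper j :
  step_coef p T d j <= (1 - P^-1)^-1 * P ^+ d * C * j.+1%:R ^+ e.
Proof.
have q1 : 0 <= (1 - P^-1)^-1 by rewrite invr_ge0 subr_ge0 invf_le1 // ltW.
apply: (le_trans (step_coef_le p_gt1 T d j)); rewrite -!mulrA ler_wpM2l //.
have /andP[_ up] := T_bounds (j - d); rewrite delayed_split //.
apply: ler_pM.
- by rewrite exprn_ge0 // ltW.
- by apply: le_trans (T_ge _); rewrite invr_ge0 ltW.
- by rewrite ler_weXn2l ?ltW // geq_minr.
- apply: (le_trans up); rewrite ler_wpM2l ?(ltW C0) //.
  by apply: lerXn2r; rewrite ?nnegrE ?ler0n // ler_nat ltnS leq_subr.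
Qed.

Lemma sum_powers_le n : \sum_(i < n.+1) P ^+ i <= 2 * P ^+ n.
Proof.
elim: n => [|n IH]; first by rewrite big_ord1 expr0; lra.
rewrite big_ord_recr /= exprS; have P2 : 2 <= P by rewrite ler_nat.
have : 0 <= P ^+ n by rewrite exprn_ge0 // ltW.
by move: IH; nra.
Qed.

(** The last coefficient alone gives the lower bound; for the upper bound the
    factors p^i form a geometric progression, whose sum is at most 2 p^n. *)
Lemma subalg_coef_growth : exists c1 c2 : R, 0 < c1 /\ forall n,
  c1 * (P ^+ n * n%:R ^+ e.+1) <= \sum_(i < n.+1) subalg_coef p T d i /\
  ((0 < n)%N -> \sum_(i < n.+1) subalg_coef p T d i <= c2 * (P ^+ n * n%:R ^+ e.+1)).
Proof.
set g := step_coef p T d.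
pose c' := c / d.+1%:R ^+ e; pose C' := (1 - P^-1)^-1 * P ^+ d * C.
have c'0 : 0 < c' by rewrite divr_gt0 // exprn_gt0 // ltr0n.
have C'0 : 0 <= C'.
  by rewrite !mulr_ge0 ?exprn_ge0 ?invr_ge0 ?subr_ge0 ?invf_le1 ?ltW.
have lower := step2_sum_lower (ltW c'0) e1 step_coef_lower.
have upper := step2_sum_upper C'0 step_coef_upper.
exists (c' / 4), (C' * 2 ^+ e.+1 * 2); split; first by rewrite divr_gt0.
move=> n; split.
  rewrite big_ord_recr /=; apply: ler_wpDl.
    by apply: sumr_ge0 => i _; exact: subalg_coef_ge0.
  rewrite mulrCA /subalg_coef ler_wpM2l ?exprn_ge0 ?(ltW P_gt0) //.
  by rewrite mulrAC ler_pdivrMr // [leRHS]mulrC.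
move=> n0; apply: (@le_trans _ _ (\sum_(i < n.+1) P ^+ i * (C' * n.+1%:R ^+ e.+1))).
  apply: ler_sum => i _; rewrite /subalg_coef ler_wpM2l ?exprn_ge0 ?(ltW P_gt0) //.
  apply: (le_trans (upper i)); rewrite ler_wpM2l //.
  by apply: lerXn2r; rewrite ?nnegrE ?ler0n // ler_nat.
rewrite -mulr_suml; apply: (@le_trans _ _ ((2 * P ^+ n) * (C' * (2 * n%:R) ^+ e.+1))).
  apply: ler_pM; rewrite ?sum_powers_le //.
  - by apply: sumr_ge0 => i _; rewrite exprn_ge0 // ltW.
  - by rewrite mulr_ge0 // exprn_ge0.
  - rewrite ler_wpM2l //; apply: lerXn2r; rewrite ?nnegrE -?natrM ?ler0n // ler_nat; lia.
by rewrite exprMn le_eqVlt; apply/orP; left; apply/eqP; ring.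
Qed.
End Bounds.
End CoefficientGrowth.

(** * The subalgebra zeta function and the growth theorem *)

Section Subalgebras.
Variables (R : realType) (p : nat) (p_prime : prime p) (L : lieAlgebra p).

Definition finite_index_subalgebras : set (set L) :=
  [set H | subalgebra H /\ finite_index H].

(** H itself is one of its cosets. *)
Lemma index_gt0 (H : set L) : finite_index H -> (0 < Defs.index H)%N.
Proof.
move=> fH; rewrite cardfs_gt0; apply/fset0Pn.
by exists [set y | H (y - 0)]; rewrite in_fset_set // inE; exists 0.
Qed.

Lemma subalgebra_zeta_nat N :
  complex.Re (subalgebra_zeta (R := R) L N%:R) =
  fine (\esum_(H in finite_index_subalgebras) ((Defs.index H)%:R ^- N)%:E).
Proof.
have E H : finite_index_subalgebras H ->
    complex.Re (cpow (Defs.index H)%:R (- (N%:R : complex R))) = (Defs.index H)%:R ^- N.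
  by move=> [_ /index_gt0 H0]; rewrite cpow_natN ?ltr0n.
rewrite /subalgebra_zeta /csum /= /rsum.
rewrite [X in _ - fine X]esum1 => [|H /E HE]; last first.
  rewrite /= /funrneg /= HE; congr EFin; apply/max_idPr.
  by rewrite oppr_le0 invr_ge0 exprn_ge0.
rewrite subr0; congr fine; apply: eq_esum => H /E HE.
by rewrite /= /funrpos /= HE; congr EFin; apply/max_idPl; rewrite invr_ge0 exprn_ge0.
Qed.

Lemma nb_subalgebras_uptoE M :
  nb_subalgebras_upto L M =
  #|` fset_set [set H | finite_index_subalgebras H /\ (Defs.index H <= M)%N]|.
Proof.
congr (#|` fset_set _|); apply/seteqP; split=> H.
  by move=> [? ? ?].
by move=> [[? ?] ?].
Qed.
End Subalgebras.
Arguments finite_index_subalgebras {p} L _.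

Section ZetaFormula.
Variables (R : realType) (p : nat) (p_prime : prime p).
Variables (mu : {measure set (padic_borel p 2) -> \bar R}) (mu_haar : normalised_haar mu).
Local Notation P := (p%:R : R).
Local Notation toC := (real_complex R).

Let P_gt0 : 0 < P. Proof. by rewrite ltr0n prime_gt0. Qed.

Lemma zeta_p_nat n : zeta_p p (n%:R : complex R) = toC ((1 - P ^- n)^-1).
Proof.
have -> : zeta_p p (n%:R : complex R) = (1 - cpow P (- n%:R))^-1 by [].
by rewrite cpow_natN // [RHS]fmorphV rmorphB rmorph1.
Qed.

(** At a natural number N every factor of the formula is real; N is taken greater
    than 2 so that the Igusa integral has the positive exponent N - 2. *)
Lemma zeta_formula_nat L star k iota : zeta_formula mu L star k iota ->
  exists2 delta : padic p, has_type star k delta & exists N0 : nat,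
  forall N, (N0 <= N)%N ->
  exists s : R, fine (\esum_(H in finite_index_subalgebras L) ((Defs.index H)%:R ^- N)%:E) = s /\
    series (fun n => subalg_coef p (form_measure R delta) iota n * (P ^- N) ^+ n) @ \oo --> s.
Proof.
move=> [delta ht [sigma formula]]; exists delta => //.
exists (maxn 3 (Num.truncn `|sigma|).+1) => N; rewrite geq_max => /andP[N3 Nsigma].
have sN : sigma < complex.Re (N%:R : complex R).
  have -> : (N%:R : complex R) = toC N%:R by rewrite rmorph_nat.
  apply: (le_lt_trans (ler_norm _)); apply: (lt_le_trans (truncnS_gt _)).
  by rewrite ler_nat.
have N2 : (0 < N - 2)%N by lia.
have [Z [igusaE TZ]] := igusa_zeta_nat p_prime mu_haar delta N2.
have p_gt1 := prime_gt1 p_prime.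
have lim := subalg_coef_series (d := iota) p_gt1 (form_measure0 p_prime mu_haar delta)
  (density_ge R p_prime delta) N3 TZ.
eexists; split; last exact: lim.
rewrite -subalgebra_zeta_nat // formula // {formula}.
set C := complex R.
have e2 : (N%:R : C) - 2 = (N - 2)%:R by rewrite natrB //; lia.
have e1 : (N%:R : C) - 1 = (N - 1)%:R by rewrite natrB //; lia.
have e3 : 2 * (N%:R : C) - 2 = (2 * N - 2)%:R by rewrite natrB ?natrM //; lia.
have e4 : (2 - (N%:R : C)) * iota.+1%:R = - ((N - 2) * iota.+1)%:R.
  by rewrite natrM -mulNr -e2 opprB.
rewrite /zeta_Zp3 e1 e2 e3 e4 igusaE !zeta_p_nat cpow_natN //.
have -> : (1 - (p%:R : C)^-1)^-1 = toC ((1 - P^-1)^-1).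
  by rewrite [RHS]fmorphV rmorphB rmorph1 fmorphV rmorph_nat.
rewrite -!rmorphM -rmorphB /=.
have Pk j : P ^+ j != 0 by rewrite expf_neq0 // gt_eqF.
have u1 : P ^- (N - 1) = P * P ^- N.
  have {2}-> : N = (1 + (N - 1))%N by lia.
  by rewrite exprD invfM mulrA divff ?mul1r // gt_eqF.
have u2 : P ^- (N - 2) = P ^+ 2 * P ^- N.
  have {2}-> : N = (2 + (N - 2))%N by lia.
  by rewrite exprD invfM mulrA divff ?mul1r.
have u3 : P ^- (2 * N - 2) = P ^+ 2 * (P ^- N) ^+ 2.
  have {2}-> : N = (1 + (N - 1))%N by lia.
  have -> : (2 * N - 2 = (N - 1) * 2)%N by lia.
  by rewrite exprD invfM exprMn expr1 mulrA -exprMn divff ?expr1n ?mul1r ?exprVn -?exprM // gt_eqF.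
have u4 : P ^- ((N - 2) * iota.+1) = (P ^+ 2 * P ^- N) ^+ iota.+1.
  by rewrite exprM -exprVn u2.
by rewrite u4 u1 u2 u3 -!mulrA; congr (_ - _ * _); ring.
Qed.
End ZetaFormula.

Theorem corollary4p2 (R : realType) (p : nat) (p_prime : prime p) (p_ge3 : (3 <= p)%N)
    (mu : {measure set (padic_borel p 2) -> \bar R}) (mu_haar : normalised_haar mu)
    (L : lieAlgebra p) (L_rank3 : free_of_rank 3 L) (L_soluble : soluble L)
    (L_assoc : associated_DEFG L)
    (star : square_type) (k iota : nat) (L_zeta : zeta_formula mu L star k iota) :
  exists c1 c2 : R, 0 < c1 /\
    forall n : nat,
      let sigma_n := (nb_subalgebras_upto L (p ^ n))%:R in
      let g := p%:R ^+ n * n%:R ^+ growth_exponent star k in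
      c1 * g <= sigma_n /\ ((0 < n)%N -> sigma_n <= c2 * g).
Proof.
have p_gt1 := prime_gt1 p_prime.
have [delta ht [N0 zetaE]] := zeta_formula_nat p_prime mu_haar L_zeta.
pose T := form_measure R delta.
have T0 : T 0 = 1 := form_measure0 p_prime mu_haar delta.
have T_ge : forall j, p%:R^-1 <= p%:R ^+ j * T j := density_ge R p_prime delta.
pose a := subalg_coef p T iota.
have a_ge0 n : 0 <= a n by exact: subalg_coef_ge0.
pose D := finite_index_subalgebras L.
have index_D H : D H -> (0 < Defs.index H)%N by move=> [_ /index_gt0].
have [s sE] : exists s : nat -> R, forall N, (N0 <= N)%N ->
    (\esum_(H in D) ((Defs.index H)%:R ^- N)%:E = (s N)%:E)%E /\
    series (fun n => a n * (p%:R ^- N) ^+ n) @ \oo --> s N.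
  exists (fun N => fine (\esum_(H in D) ((Defs.index H)%:R ^- N)%:E)%E) => N /zetaE[_ [<-]].
  set s := \esum_(_ in _) _ => lim; split=> //.
  have s_ge1 : 1 <= fine s.
    have term_ge0 n : 0 <= a n * (p%:R ^- N) ^+ n.
      by rewrite mulr_ge0 // exprn_ge0 // invr_ge0 exprn_ge0.
    have := series_le_lim 1 term_ge0 lim.
    by rewrite /series /= big_nat1 expr0 mulr1 /a subalg_coef0.
  (* fine sends an infinite sum to 0, which s_ge1 excludes. *)
  by case: s s_ge1 lim => [r| |] //=; rewrite ler10.
have fib N : (N0 <= N)%N -> (forall m, finite_set (fibre D (@Defs.index p L) m)) /\
    series (fun m => fibre_card R D (@Defs.index p L) m / m%:R ^+ N) @ \oo --> s N.
  by move=> /sE[hs _]; exact: fibre_card_series.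
have coefE : fibre_card R D (@Defs.index p L) =1 prime_power_coef p a.
  apply: (@dirichlet_coef_eq _ _ _ s N0).
  - by move=> m.
  - by move=> m; exact: prime_power_coef_ge0.
  - rewrite /prime_power_coef /= logn0 expn0 /=; rewrite /fibre_card.
    rewrite (_ : fibre _ _ 0 = set0) ?fset_set0 //.
    by apply/seteqP; split=> // H [/index_D + H0]; rewrite H0.
  - by move=> N /fib[].
  - by move=> N /sE[_]; exact: prime_power_series.
have sigmaE n : (nb_subalgebras_upto L (p ^ n))%:R = \sum_(i < n.+1) a i.
  rewrite nb_subalgebras_uptoE card_fset_set_le; last by move=> m; case: (fib N0).
  by rewrite -[RHS](sum_prime_power p_prime) //; apply: eq_bigr => m _; exact: coefE.
have [c [C [c0 C0 T_bounds]]] := density_bounds R p_prime p_ge3 ht.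
have e1 : ((growth_exponent star k).-1 <= 1)%N by case: (star) => //=; case: odd.
have eE : (growth_exponent star k).-1.+1 = growth_exponent star k.
  by case: (star) => //=; case: odd.
have [c1 [c2 [c1_gt0 growth]]] := subalg_coef_growth p_gt1 iota T0 T_ge e1 c0 C0 T_bounds.
by exists c1, c2; split=> // n sigma_n g; rewrite /sigma_n /g sigmaE -eE; exact: growth.
Qed.
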